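(* For every $n\ge2$, the topological closure of $\mathcal{PMV}(n,2)$ in $\mathbb R^{\binom n2}$ is a semialgebraic set.
   Context: $\mathcal K_2$ denotes the set of nonempty compact convex subsets of $\mathbb R^2$. The mixed area of $K,L\in\mathcal K_2$ is $\mathrm V(K,L)=\tfrac12\big(\mathrm{Vol}_2(K+L)-\mathrm{Vol}_2(K)-\mathrm{Vol}_2(L)\big)$. $\mathcal{PMV}(n,2)=\{(\mathrm V(K_i,K_j))_{\{i,j\}\subset[n]}\in\mathbb R^{\binom n2} : K_1,\dots,K_n\in\mathcal K_2\}$. *)

(* Defs.v *)
From HB Require Import structures.
From mathcomp Require Import all_boot all_order all_algebra.
From mathcomp Require Import all_classical all_reals all_analysis.
Set Implicit Arguments. Unset Strict Implicit. Unset Printing Implicit Defensive.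
Import Order.TTheory GRing.Theory Num.Theory.
Import numFieldNormedType.Exports.
Local Open Scope classical_set_scope.
Local Open Scope ring_scope.

Section Defs.
Variable R : realType.

Definition msum (K L : set (R * R)) : set (R * R) :=
  [set p | exists a b, K a /\ L b /\ p = (a.1 + b.1, a.2 + b.2)].

Definition convex_set2 (K : set (R * R)) : Prop :=
  forall a b (t : R), K a -> K b -> 0 <= t <= 1 ->
    K (t * a.1 + (1 - t) * b.1, t * a.2 + (1 - t) * b.2).

Definition convex_body2 (K : set (R * R)) : Prop :=
  K !=set0 /\ compact K /\ convex_set2 K.

Definition vol2 (K : set (R * R)) : R :=
  fine (((@lebesgue_measure R) \x (@lebesgue_measure R))%E K).

Definition mixed_area (K L : set (R * R)) : R :=
  (vol2 (msum K L) - vol2 K - vol2 L) / 2.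

Definition pair_index (n : nat) := {p : 'I_n * 'I_n | (p.1 < p.2)%N}.

Definition PMV (n : nat) : set (pair_index n -> R) :=
  [set x | exists K : 'I_n -> set (R * R),
     (forall i, convex_body2 (K i)) /\
     forall p : pair_index n, x p = mixed_area (K (val p).1) (K (val p).2)].

(* Topological closure in R^I (I finite), with its Euclidean topology
   (equivalently, the sup-norm / product topology) *)
Definition closureRI (I : finType) (S : set (I -> R)) : set (I -> R) :=
  [set x | forall e : R, 0 < e -> exists y, S y /\ forall i, `|x i - y i| < e].

Inductive rpoly (I : Type) : Type :=
| PConst of R
| PVar of I
| PAdd of rpoly I & rpoly I
| PMul of rpoly I & rpoly I.

Fixpoint peval (I : Type) (p : rpoly I) (x : I -> R) : R :=
  match p with
  | PConst c => c
  | PVar i => x i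
  | PAdd p q => peval p x + peval q x
  | PMul p q => peval p x * peval q x
  end.

Definition semialgebraic (I : Type) (S : set (I -> R)) : Prop :=
  exists bs : seq (rpoly I * seq (rpoly I)),
    S = [set x | has (fun b => (peval b.1 x == 0) &&
                               all (fun g => 0 < peval g x) b.2) bs].

End Defs.

(* Main.v *)
From mathcomp Require Import all_boot all_order all_algebra.
From mathcomp Require Import all_classical all_reals all_analysis.
From mathcomp Require finmap.
From mathcomp Require Import measurable_realfun.
From mathcomp Require Import ordered_qelim qe_rcf.
From mathcomp Require Import ring lra.
(* last, because mathcomp-analysis has another [msum] *)
Require Import Defs.

(** A convex polygon is determined, up to translation, by the edge vectors of its upper
    chain [E] and lower chain [F], both traversed from left to right and with the same
    sum. Its upper boundary is that of the zonotope of [E] (the Minkowski sum of the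
    segments from 0 to the edges), its lower boundary that of the zonotope of [F].
    Cutting along the chord from 0 to the common sum, and using the central symmetry of
    zonotopes, its area is half the sum of the areas of the two zonotopes; since chains
    of a Minkowski sum are obtained by concatenation, the mixed area of two polygons is
    a quarter of the sum of [|det (e, e')|] over pairs of upper edges plus the same sum
    over pairs of lower edges.

    This expression is bilinear and positively homogeneous in the edges. Hence, for fixed
    other polygons, Caratheodory's theorem for cones replaces each chain by one with at
    most [n + 2] edges without changing its sum or the mixed areas with the others.
    As polygons approximate convex bodies and area is continuous on compact sets under
    outer approximation, the closure of [PMV] is the closure of a set described by a
    fixed number of real parameters. It is therefore first-order definable, and
    semialgebraic by quantifier elimination. *)

Set Implicit Arguments. Unset Strict Implicit. Unset Printing Implicit Defensive.
Import Order.TTheory GRing.Theory Num.Theory.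
Import numFieldNormedType.Exports.
Local Open Scope classical_set_scope.
Local Open Scope ring_scope.

(** * Semialgebraic and definable sets *)

Section Semialgebraic.
Variable R : realType.

Definition basic_holds (I : Type) (x : I -> R) (b : rpoly R I * seq (rpoly R I)) :=
  (peval b.1 x == 0) && all (fun g => 0 < peval g x) b.2.

Lemma semialgebraicU (I : Type) (A B : set (I -> R)) :
  semialgebraic A -> semialgebraic B -> semialgebraic (A `|` B).
Proof.
move=> [bs ->] [cs ->]; exists (bs ++ cs); apply/seteqP; split => x /=.
  by rewrite has_cat => -[->|->]; rewrite ?orbT.
by rewrite has_cat => /orP[]; [left|right].
Qed.

(** Conjunction distributes over the two finite unions. A basic set carries a single equation, so
    [p = 0] and [q = 0] are merged into [p * p + q * q = 0], which is equivalent over the reals. *)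
Lemma semialgebraicI (I : Type) (A B : set (I -> R)) :
  semialgebraic A -> semialgebraic B -> semialgebraic (A `&` B).
Proof.
move=> [bs ->] [cs ->].
pose m (b c : rpoly R I * seq (rpoly R I)) :=
  (PAdd (PMul b.1 b.1) (PMul c.1 c.1), b.2 ++ c.2).
have mE b c x : basic_holds x (m b c) = basic_holds x b && basic_holds x c.
  rewrite /basic_holds /= all_cat -!expr2 paddr_eq0 ?sqr_ge0// !sqrf_eq0.
  by rewrite -!andbA; congr (_ && _); rewrite andbCA.
exists [seq m b c | b <- bs, c <- cs]; apply/seteqP.
suff mm x : has (basic_holds x) [seq m b c | b <- bs, c <- cs] =
    has (basic_holds x) bs && has (basic_holds x) cs.
  split=> x /=; have := mm x; rewrite /basic_holds => ->; first by move=> [-> ->].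
  by move=> /andP.
elim: bs => //= b bs IH; rewrite has_cat IH has_map.
have -> : has (preim (m b) (basic_holds x)) cs =
    basic_holds x b && has (basic_holds x) cs.
  by elim: cs {IH} => [|c cs /= ->]; rewrite ?andbF //= mE; case: (basic_holds x b).
by case: (basic_holds x b); case: (has _ cs); case: (has _ bs).
Qed.

Lemma semialgebraicT (I : Type) : semialgebraic [set: I -> R].
Proof.
exists [:: (PConst I 0, [::])]; apply/seteqP; split => // x _ /=.
by rewrite eqxx.
Qed.

Lemma semialgebraic0 (I : Type) : semialgebraic (set0 : set (I -> R)).
Proof. by exists [::]; apply/seteqP; split. Qed.

Lemma semialgebraic_eq0 (I : Type) (p : rpoly R I) :
  semialgebraic [set x | peval p x = 0].
Proof.
exists [:: (p, [::])]; apply/seteqP; split => x /=.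
  by move=> ->; rewrite eqxx.
by rewrite andbT orbF => /eqP.
Qed.

Lemma semialgebraic_gt0 (I : Type) (p : rpoly R I) :
  semialgebraic [set x | 0 < peval p x].
Proof.
exists [:: (PConst I 0, [:: p])]; apply/seteqP; split => x /=.
  by move=> ->; rewrite eqxx.
by rewrite eqxx andbT orbF.
Qed.

(** De Morgan, by induction on the list of basic sets and then on the inequalities of each: the
    negation of [p = 0] is [0 < p * p], that of [0 < g] is [g = 0] or [0 < - g]. *)
Lemma semialgebraicC (I : Type) (A : set (I -> R)) :
  semialgebraic A -> semialgebraic (~` A).
Proof.
move=> [bs ->]; elim: bs => [|[p gs] bs IH].
  have -> : ~` [set x : I -> R | has (basic_holds x) [::]] = setT.
    by apply/seteqP; split.
  exact: semialgebraicT.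
rewrite [X in semialgebraic X](_ : _ =
  ~` [set x | basic_holds x (p, gs)] `&` ~` [set x | has (basic_holds x) bs]);
  last first.
  apply/seteqP; split => x /=.
    by rewrite /basic_holds /= => /negP; rewrite negb_or => /andP[/negP ? /negP].
  by rewrite /basic_holds /= => -[/negP a /negP b]; apply/negP; rewrite negb_or a.
apply: semialgebraicI => //=.
rewrite [X in semialgebraic X](_ : _ =
  [set x | 0 < peval (PMul p p) x] `|`
  ~` [set x | all (fun g => 0 < peval g x) gs]); last first.
  apply/seteqP; split => x /=; rewrite /basic_holds /= -expr2 exprn_even_gt0//=.
    by move=> /negP; rewrite negb_and => /orP[->|/negP]; [left|right].
  by move=> [a|/negP a]; apply/negP; rewrite negb_and a ?orbT.
apply: semialgebraicU; first exact: semialgebraic_gt0.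
elim: gs => [|g gs IHg].
  have -> : ~` [set x : I -> R | all (fun g => 0 < peval g x) [::]] = set0.
    by apply/seteqP; split => // x /=; case.
  exact: semialgebraic0.
rewrite [X in semialgebraic X](_ : _ =
  ([set x | peval g x = 0] `|` [set x | 0 < peval (PMul (PConst I (-1)) g) x])
  `|` ~` [set x | all (fun g => 0 < peval g x) gs]); last first.
  apply/seteqP; split => x /=; rewrite mulN1r oppr_gt0.
    move=> /negP; rewrite negb_and -leNgt le_eqVlt => /orP[/orP[/eqP a|a]|/negP a].
    - by left; left.
    - by left; right.
    - by right.
  move=> h; apply/negP; rewrite negb_and -leNgt le_eqVlt.
  by case: h => [[->|->]|/negP ->]; rewrite ?eqxx ?orbT.
apply: semialgebraicU => //; apply: semialgebraicU.
  exact: semialgebraic_eq0.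
exact: semialgebraic_gt0.
Qed.

Fixpoint psubst (I J : Type) (s : J -> rpoly R I) (p : rpoly R J) : rpoly R I :=
  match p with
  | PConst c => PConst I c
  | PVar j => s j
  | PAdd p q => PAdd (psubst s p) (psubst s q)
  | PMul p q => PMul (psubst s p) (psubst s q)
  end.

Lemma peval_psubst (I J : Type) (s : J -> rpoly R I) p x :
  peval (psubst s p) x = peval p (fun j => peval (s j) x).
Proof. by elim: p => //= p -> q ->. Qed.

Lemma semialgebraic_preimage (I J : Type) (s : J -> rpoly R I) (A : set (J -> R)) :
  semialgebraic A -> semialgebraic [set x | A (fun j => peval (s j) x)].
Proof.
move=> [bs ->]; exists [seq (psubst s b.1, map (psubst s) b.2) | b <- bs].
apply/seteqP; split => x /=; rewrite has_map; apply: sub_has => b /=;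
  rewrite peval_psubst all_map => /andP[-> h] /=; apply: sub_all h => g /=;
  by rewrite peval_psubst.
Qed.

End Semialgebraic.

(** * First-order definable sets and quantifier elimination *)

Section Definable.
Variable R : realType.

(** Formulas number their variables by naturals; [pickle] lets them be named by elements of [V].
    Only valuations read off finite sequences (0 past the end) are tested, which for a finite [V]
    are all valuations. *)
Definition definable (V : countType) (P : (V -> R) -> Prop) : Prop :=
  exists f : ord.formula R, forall e : seq R,
    P (fun i => e`_(pickle i)) <-> ord.holds e f.

Definition polynomial_fun (V : countType) (G : (V -> R) -> R) : Prop :=
  exists t : GRing.term R, forall e : seq R,
    GRing.eval e t = G (fun i => e`_(pickle i)).

Lemma eq_definable (V : countType) (P Q : (V -> R) -> Prop) :
  (forall v, P v <-> Q v) -> definable P -> definable Q.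
Proof. by move=> PQ [f fP]; exists f => e; rewrite -PQ. Qed.

Section Closure.
Variable V : countType.
Implicit Types (P Q : (V -> R) -> Prop) (G H : (V -> R) -> R).

Lemma polynomial_var (i : V) : polynomial_fun (fun v => v i).
Proof. by exists (GRing.Var R (pickle i)). Qed.

Lemma polynomial_const (c : R) : polynomial_fun (fun _ : V -> R => c).
Proof. by exists (GRing.Const c). Qed.

Lemma polynomialD G H : polynomial_fun G -> polynomial_fun H ->
  polynomial_fun (fun v => G v + H v).
Proof. by move=> [t tE] [u uE]; exists (GRing.Add t u) => e /=; rewrite tE uE. Qed.

Lemma polynomialM G H : polynomial_fun G -> polynomial_fun H ->
  polynomial_fun (fun v => G v * H v).
Proof. by move=> [t tE] [u uE]; exists (GRing.Mul t u) => e /=; rewrite tE uE. Qed.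

Lemma polynomialN G : polynomial_fun G -> polynomial_fun (fun v => - G v).
Proof. by move=> [t tE]; exists (GRing.Opp t) => e /=; rewrite tE. Qed.

Lemma polynomialB G H : polynomial_fun G -> polynomial_fun H ->
  polynomial_fun (fun v => G v - H v).
Proof. by move=> pG pH; apply: polynomialD => //; exact: polynomialN. Qed.

Lemma polynomial_sum (T : Type) (s : seq T) (G : T -> (V -> R) -> R) :
  (forall k, polynomial_fun (G k)) ->
  polynomial_fun (fun v => \sum_(k <- s) G k v).
Proof.
move=> pG; elim: s => [|k s [t tE]].
  by exists (GRing.Const 0) => e /=; rewrite big_nil.
have [u uE] := pG k; exists (GRing.Add u t) => e /=.
by rewrite big_cons tE uE.
Qed.

Lemma definable_eq G H : polynomial_fun G -> polynomial_fun H ->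
  definable (fun v => G v = H v).
Proof. by move=> [t tE] [u uE]; exists (ord.Equal t u) => e /=; rewrite tE uE. Qed.

Lemma definable_lt G H : polynomial_fun G -> polynomial_fun H ->
  definable (fun v => G v < H v).
Proof. by move=> [t tE] [u uE]; exists (ord.Lt t u) => e /=; rewrite tE uE. Qed.

Lemma definable_le G H : polynomial_fun G -> polynomial_fun H ->
  definable (fun v => G v <= H v).
Proof. by move=> [t tE] [u uE]; exists (ord.Le t u) => e /=; rewrite tE uE. Qed.

Lemma definable_and P Q : definable P -> definable Q ->
  definable (fun v => P v /\ Q v).
Proof. by move=> [f fE] [g gE]; exists (ord.And f g) => e /=; rewrite fE gE. Qed.

Lemma definable_implies P Q : definable P -> definable Q ->
  definable (fun v => P v -> Q v).
Proof. by move=> [f fE] [g gE]; exists (ord.Implies f g) => e /=; rewrite fE gE. Qed.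

Lemma definable_forall_fin (T : finType) (P : T -> (V -> R) -> Prop) :
  (forall t, definable (P t)) -> definable (fun v => forall t, P t v).
Proof.
move=> dP; apply: (@eq_definable _ (fun v => forall t, t \in enum T -> P t v)).
  move=> v; split=> [h t|h t _]; last exact: h.
  by apply: h; rewrite mem_enum.
elim: (enum T) => [|t s IH].
  by exists (ord.Bool true) => e; split.
apply: eq_definable (definable_and (dP t) IH) => v; split.
  by move=> [h1 h2] u; rewrite inE => /orP[/eqP ->//|]; exact: h2.
move=> h; split; first by apply: h; rewrite mem_head.
by move=> u us; apply: h; rewrite inE us orbT.
Qed.

Definition update (v : V -> R) (j : V) (c : R) (i : V) : R :=
  if i == j then c else v i.

Lemma nth_update (e : seq R) (j : V) c :
  (fun i : V => (set_nth 0 e (pickle j) c)`_(pickle i)) =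
  update (fun i => e`_(pickle i)) j c.
Proof.
apply/funext => i; rewrite nth_set_nth /= /update.
by rewrite (inj_eq (pcan_inj (@pickleK V))).
Qed.

Lemma definable_forall (j : V) P : definable P ->
  definable (fun v => forall c, P (update v j c)).
Proof.
move=> [f fE]; exists (ord.Forall (pickle j) f) => e /=.
by split=> h c; [rewrite -fE nth_update|rewrite -nth_update fE]; exact: h.
Qed.

Lemma definable_exists (j : V) P : definable P ->
  definable (fun v => exists c, P (update v j c)).
Proof.
move=> [f fE]; exists (ord.Exists (pickle j) f) => e /=.
by split=> -[c h]; exists c; [rewrite -fE nth_update|rewrite -nth_update fE].
Qed.

(** One existential quantifier per element of [s]; the values chosen one by one are collected in a
    single function [c]. *)
Lemma definable_exists_block (s : seq V) P : definable P ->
  definable (fun v => exists c : V -> R,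
    P (fun i => if i \in s then c i else v i)).
Proof.
move=> dP; elim: s => [|j s IH].
  by apply: eq_definable dP => v; split=> [h|[c]//]; exists v.
apply: eq_definable (definable_exists j IH) => v; split.
  (* Only the values on [j :: s] matter, so the value [d] of the outer quantifier can be stored
     everywhere off [s]. If [j] already occurs in [s], the inner choice prevails on both sides. *)
  move=> [d [c h]]; exists (fun i => if i \in s then c i else d).
  congr (P _): h; apply/funext => i; rewrite inE /update.
  by case: (i \in s) => //=; rewrite ?orbT ?orbF//; case: ifP.
move=> [c h]; exists (c j); exists c.
congr (P _): h; apply/funext => i; rewrite inE /update.
by case: (i \in s) => //=; rewrite ?orbT ?orbF//; case: eqP => [->|].
Qed.

End Closure.

(** Terms without inverses are polynomials. The entries of the environment may be any polynomials
    [s k], which covers both the coordinates of the point and the default value 0. *)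
Lemma rterm_rpoly (I : Type) (s : nat -> rpoly R I) (env : (I -> R) -> seq R) :
  (forall x k, (env x)`_k = peval (s k) x) ->
  forall t : GRing.term R, GRing.rterm t ->
  exists p : rpoly R I, forall x, GRing.eval (env x) t = peval p x.
Proof.
move=> envE; elim => //=.
- by move=> k _; exists (s k).
- by move=> c _; exists (PConst I c).
- by move=> k _; exists (PConst I k%:R).
- move=> t1 IH1 t2 IH2 /andP[/IH1[p pE] /IH2[q qE]]; exists (PAdd p q) => x.
  by rewrite pE qE.
- move=> t IH /IH[p pE]; exists (PMul (PConst I (-1)) p) => x.
  by rewrite /= pE mulN1r.
- move=> t IH k /IH[p pE]; exists (PMul (PConst I k%:R) p) => x.
  by rewrite /= pE mulr_natl.
- move=> t1 IH1 t2 IH2 /andP[/IH1[p pE] /IH2[q qE]]; exists (PMul p q) => x.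
  by rewrite pE qE.
- move=> t IH k /IH[p pE]; exists (iter k (PMul p) (PConst I 1)) => x.
  by rewrite pE; elim: k => [|k IHk] /=; rewrite ?expr0 // exprS IHk.
Qed.

Lemma qf_semialgebraic (I : Type) (s : nat -> rpoly R I) (env : (I -> R) -> seq R) :
  (forall x k, (env x)`_k = peval (s k) x) ->
  forall f : ord.formula R, ord.qf_form f -> ord.rformula f ->
  semialgebraic [set x | ord.qf_eval (env x) f].
Proof.
move=> envE; have tp := rterm_rpoly envE; elim => //=.
- case=> _ _; [rewrite [X in semialgebraic X](_ : _ = setT)|
               rewrite [X in semialgebraic X](_ : _ = set0)].
  + exact: semialgebraicT.
  + by apply/seteqP; split.
  + exact: semialgebraic0.
  + by apply/seteqP; split.
- move=> t u _ /andP[/tp[p pE] /tp[q qE]].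
  rewrite [X in semialgebraic X](_ : _ =
    [set x | peval (PAdd p (PMul (PConst I (-1)) q)) x = 0]).
    exact: semialgebraic_eq0.
  apply/seteqP; split => x /=; rewrite pE qE mulN1r.
    by move=> /eqP ->; rewrite subrr.
  by move=> /eqP; rewrite subr_eq0.
- move=> t u _ /andP[/tp[p pE] /tp[q qE]].
  rewrite [X in semialgebraic X](_ : _ =
    [set x | 0 < peval (PAdd q (PMul (PConst I (-1)) p)) x]).
    exact: semialgebraic_gt0.
  by apply/seteqP; split => x /=; rewrite pE qE mulN1r subr_gt0.
- move=> t u _ /andP[/tp[p pE] /tp[q qE]].
  rewrite [X in semialgebraic X](_ : _ =
    ~` [set x | 0 < peval (PAdd p (PMul (PConst I (-1)) q)) x]).
    by apply: semialgebraicC; exact: semialgebraic_gt0.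
  apply/seteqP; split => x /=; rewrite pE qE mulN1r subr_gt0.
    by rewrite leNgt => /negP.
  by move=> /negP; rewrite -leNgt.
- move=> f IHf g IHg /andP[qf qg] /andP[rf rg].
  rewrite [X in semialgebraic X](_ : _ = [set x | ord.qf_eval (env x) f] `&`
    [set x | ord.qf_eval (env x) g]).
    by apply: semialgebraicI; [exact: IHf|exact: IHg].
  by apply/seteqP; split => x /= => [/andP//|[-> ->]].
- move=> f IHf g IHg /andP[qf qg] /andP[rf rg].
  rewrite [X in semialgebraic X](_ : _ = [set x | ord.qf_eval (env x) f] `|`
    [set x | ord.qf_eval (env x) g]).
    by apply: semialgebraicU; [exact: IHf|exact: IHg].
  by apply/seteqP; split => x /= => [/orP//|/orP].
- move=> f IHf g IHg /andP[qf qg] /andP[rf rg].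
  rewrite [X in semialgebraic X](_ : _ = ~` [set x | ord.qf_eval (env x) f] `|`
    [set x | ord.qf_eval (env x) g]).
    by apply: semialgebraicU; [exact/semialgebraicC/IHf|exact: IHg].
  apply/seteqP; split => x /=; rewrite implybE.
    by move=> /orP[/negP|]; [left|right].
  by move=> [/negP ->|->]; rewrite ?orbT.
- move=> f IHf qf rf; rewrite [X in semialgebraic X](_ : _ =
    ~` [set x | ord.qf_eval (env x) f]); first exact/semialgebraicC/IHf.
  by apply/seteqP; split => x /= /negP.
Qed.

(* Tarski-Seidenberg, through the quantifier elimination of real-closed. *)
Lemma definable_semialgebraic (V : finType) (P : (V -> R) -> Prop) :
  definable P -> semialgebraic [set v | P v].
Proof.
move=> [f fE].
(* A length exceeding every variable number, so that [env v] records all of [v]; numbers that encode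
   no element of [V] receive 0. *)
pose B := \max_(i : V) (pickle i).+1.
pose val_at (v : V -> R) k := oapp v 0 (unpickle k).
pose env v := mkseq (val_at v) B.
pose s k := if (k < B)%N then oapp (@PVar R V) (PConst V 0) (unpickle k)
            else PConst V 0.
have envE v k : (env v)`_k = peval (s k) v.
  rewrite /s; case: ltnP => kB.
    by rewrite nth_mkseq // /val_at; case: unpickle.
  by rewrite nth_default // size_mkseq.
have envK v : (fun i : V => (env v)`_(pickle i)) = v.
  apply/funext => i; rewrite nth_mkseq; first by rewrite /val_at pickleK.
  exact: (leq_bigmax (F := fun i : V => (pickle i).+1)).
(* [to_rform] removes inverses first, so the quantifier-free result only contains polynomial
   terms. *)
pose g := ord.quantifier_elim (@wproj R) (ord.to_rform f).
have /andP[qg rg] : ord.qf_form g && ord.rformula g.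
  apply: ord.quantifier_elim_wf; last exact: ord.to_rform_rformula.
  by move=> i bc; exact: wf_QE_wproj.
rewrite [X in semialgebraic X](_ : _ = [set v | ord.qf_eval (env v) g]).
  exact: (qf_semialgebraic envE).
apply/seteqP; split => v /=.
  by rewrite -{1}(envK v) fE => h; apply/(rcf_satP (env v) f).
by move=> h; rewrite -(envK v) fE; apply/(rcf_satP (env v) f).
Qed.

End Definable.

(** * Compact sets and area in the plane *)

Section PlaneTopology.
Variable R : realType.
Implicit Types (K L A B : set (R * R)) (p q : R * R).

Definition box (d : R) : set (R * R) := [set p | `|p.1| <= d /\ `|p.2| <= d].

Lemma box_compact d : compact (box d).
Proof.
rewrite (_ : box d = `[- d, d]%classic `*` `[- d, d]%classic).
  by apply: compact_setX; exact: segment_compact.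
by apply/seteqP; split => p; rewrite /box /= !in_itv /= !ler_norml.
Qed.

Lemma fst_continuous : continuous (@fst R R).
Proof. by move=> p; exact: cvg_fst. Qed.

Lemma snd_continuous : continuous (@snd R R).
Proof. by move=> p; exact: cvg_snd. Qed.

Lemma compact_image (T U : topologicalType) (f : T -> U) (A : set T) :
  continuous f -> compact A -> compact (f @` A).
Proof. by move=> cf; apply: continuous_compact; exact: continuous_subspaceT. Qed.

Lemma compact_msum K L : compact K -> compact L -> compact (msum K L).
Proof.
move=> cK cL.
rewrite (_ : msum K L = (fun z => z.1 + z.2) @` (K `*` L)).
  apply: compact_image; last exact: compact_setX.
  exact: add_continuous.
apply/seteqP; split => [p [a [b [Ka [Lb ->]]]]|p [[a b] [Ka Lb] <-]].
  by exists (a, b).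
by exists a, b.
Qed.

Lemma compact_closed2 K : compact K -> closed K.
Proof. by move=> cK; exact: (compact_closed (@norm_hausdorff R (R * R)%type) cK). Qed.

Lemma compact_preimage K (f : R * R -> R) (A : set R) :
  continuous f -> closed A -> compact K -> compact (K `&` f @^-1` A).
Proof.
move=> cf cA cK; apply: (subclosed_compact _ cK (@subIsetl _ _ _)).
apply: closedI; first exact: compact_closed2.
by apply: preimage_closed.
Qed.

Lemma compact_ball_cover (V : normedModType R) (A : set V) (d : R) :
  compact A -> 0 < d -> exists s : seq V, (forall v, v \in s -> A v) /\
    forall w, A w -> exists2 v, v \in s & ball v d w.
Proof.
move=> + d0; rewrite compact_cover => /(_ V A (fun v => ball v d)) [].
- by move=> v _; exact: ball_open.
- by move=> v Kv; exists v => //; exact: ballxx.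
move=> D DK cov; exists (finmap.enum_fset D); split.
  by move=> v vD; have := DK v vD; rewrite inE.
by move=> w /cov[v vD b]; exists v.
Qed.

Lemma compact_net K (d : R) : compact K -> 0 < d ->
  exists s : seq (R * R), (forall p, p \in s -> K p) /\
    forall q, K q -> exists p, [/\ p \in s, `|q.1 - p.1| < d & `|q.2 - p.2| < d].
Proof.
move=> cK d0; have [s [sK sN]] := compact_ball_cover (V := (R * R)%type) cK d0.
exists s; split=> // q /sN[p ps [b1 b2]]; exists p; split => //.
  by rewrite distrC.
by rewrite distrC.
Qed.

Lemma compact_bounded2 K : compact K ->
  exists2 M : R, 0 <= M & forall p, K p -> `|p.1| <= M /\ `|p.2| <= M.
Proof.
move=> cK; have [s [sK sN]] := compact_net cK (@ltr01 R).
exists (\sum_(p <- s) (`|p.1| + `|p.2|) + 1).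
  by apply: addr_ge0 => //; apply: sumr_ge0 => p _; exact: addr_ge0.
move=> q /sN[p [ps h1 h2]].
have hp : `|p.1| + `|p.2| <= \sum_(p <- s) (`|p.1| + `|p.2|).
  rewrite (big_rem p) //= lerDl; apply: sumr_ge0 => r _; exact: addr_ge0.
have := ler_normD (q.1 - p.1) p.1; have := ler_normD (q.2 - p.2) p.2.
rewrite !subrK => h3 h4; have := normr_ge0 p.1; have := normr_ge0 p.2.
by split; lra.
Qed.

Lemma invS_gt0 n : 0 < n.+1%:R^-1 :> R.
Proof. by rewrite invr_gt0. Qed.

Lemma ex_invS_lt (d : R) : 0 < d -> exists n : nat, n.+1%:R^-1 < d.
Proof.
move=> d0; exists (Num.truncn d^-1); rewrite invf_plt ?posrE //.
exact: truncnS_gt.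
Qed.

(** Measurability is for the product sigma-algebra, so the set is written with rectangles: being
    closed, it is the intersection over [n] of the finite unions of open squares of half-side
    [n.+1%:R^-1] centred on a finite net of it. *)
Lemma compact_measurable2 K : compact K -> measurable K.
Proof.
move=> cK.
have net n := cid (compact_net cK (invS_gt0 n)).
pose cell p n := `](p.1 - n.+1%:R^-1), (p.1 + n.+1%:R^-1)[%classic `*`
  `](p.2 - n.+1%:R^-1), (p.2 + n.+1%:R^-1)[%classic : set (R * R).
have -> : K = \bigcap_n \bigcup_(p in [set` projT1 (net n)]) cell p n.
  apply/seteqP; split => q.
    move=> Kq n _; case: (net n) => s [sK sN] /=; have [p [ps h1 h2]] := sN q Kq.
    exists p => //; rewrite /cell /=; split; rewrite /= in_itv /=.
      by move: h1; rewrite ltr_distl => /andP[-> ->].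
    by move: h2; rewrite ltr_distl => /andP[-> ->].
  move=> h; apply: (compact_closed2 cK) => B /nbhs_ballP[d /= d0 dB].
  have [n nd] := ex_invS_lt d0.
  have [p] := h n I; case: (net n) => s [sK sN] /= ps [/= h1 h2].
  exists p; split; first exact: sK.
  apply: dB; split.
    apply: lt_trans nd; move: h1; rewrite in_itv /= => /andP[a b].
    by rewrite ltr_distl a b.
  apply: lt_trans nd; move: h2; rewrite in_itv /= => /andP[a b].
  by rewrite ltr_distl a b.
apply: bigcap_measurable => // n _.
apply: fin_bigcup_measurable; first exact: finite_seq.
by move=> p _; apply: measurableX; exact: measurable_itv.
Qed.

End PlaneTopology.

(** * Area of compact sets *)

Section Volume.
Variable R : realType.
Implicit Types (K L A B : set (R * R)) (p q : R * R).

Notation lam := (@lebesgue_measure R).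
Notation mu := (lam \x lam)%E.

Lemma mu_lty K : compact K -> (mu K < +oo)%E.
Proof.
move=> cK; have [M M0 KM] := compact_bounded2 cK.
have sub : K `<=` (`[- M, M]%classic `*` `[- M, M]%classic).
  by move=> p /KM[h1 h2]; split => /=; rewrite in_itv /= -ler_norml.
have mK := compact_measurable2 cK.
pose I : set R := `[- M, M]%classic.
have mI : measurable I by exact: measurable_itv.
have le : (mu K <= mu (I `*` I))%E.
  by apply: le_measure => //; rewrite inE //; exact: measurableX.
apply: (le_lt_trans le); rewrite product_measure1E //= lebesgue_measure_itv /=.
by case: ifP => _; rewrite ?mul0e // -EFinB -EFinM ltry.
Qed.

Lemma mu_fin_num K : compact K -> mu K \is a fin_num.
Proof. by move=> cK; rewrite ge0_fin_numE; [exact: mu_lty|exact: measure_ge0]. Qed.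

Lemma vol2E K : compact K -> ((vol2 K)%:E = mu K)%E.
Proof. by move=> cK; rewrite /vol2 fineK //; exact: mu_fin_num. Qed.

Lemma vol2_le K L : compact K -> compact L -> K `<=` L -> vol2 K <= vol2 L.
Proof.
move=> cK cL KL; rewrite -lee_fin !vol2E //; apply: le_measure => //;
  by rewrite inE; exact: compact_measurable2.
Qed.

Lemma eq_vol2_xsection A B :
  (forall x, lam (xsection A x) = lam (xsection B x)) -> vol2 A = vol2 B.
Proof.
move=> AB; rewrite /vol2 /product_measure1; congr fine.
by apply: eq_integral => x _; exact: AB.
Qed.

Definition swap2 p : R * R := (p.2, p.1).

Lemma swap2_continuous : continuous swap2.
Proof.
move=> [a b]; apply: (@cvg_pair _ _ _ _ (nbhs b) (nbhs a)).
  exact: cvg_snd.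
exact: cvg_fst.
Qed.

(** Exchanging the coordinates exchanges the order of the iterated integrals, and the two product
    measures agree by uniqueness. *)
Lemma vol2_swap K : compact K -> vol2 (swap2 @` K) = vol2 K.
Proof.
move=> cK; rewrite /vol2; congr fine.
transitivity ((lam \x^ lam)%E K); last first.
  apply: esym; apply: (@product_measure_unique _ _ _ _ R lam lam (lam \x^ lam)%E).
    by move=> A B mA mB; exact: product_measure2E.
  exact: compact_measurable2.
rewrite /product_measure1 /product_measure2; apply: eq_integral => x _ /=.
congr (lam _); apply/seteqP; split => y; rewrite /xsection /ysection /= !inE.
  by move=> [[a b] Kab [<- <-]].
by move=> Kyx; exists (y, x).
Qed.

(** Continuity of the measure from above: the compact neighbourhoods [F n] decrease to [K] because
    [K] is closed, and any [L] between [K] and [F n] has its area squeezed. *)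
Lemma vol2_outer_continuous K (e : R) : compact K -> 0 < e ->
  exists2 d, 0 < d & forall L, compact L -> K `<=` L ->
    L `<=` msum K (box d) -> vol2 K <= vol2 L < vol2 K + e.
Proof.
move=> cK e0; pose F n := msum K (box (n.+1%:R^-1)).
have cF n : compact (F n) by apply: compact_msum => //; exact: box_compact.
have FK : \bigcap_n F n = K.
  apply/seteqP; split => q; last first.
    move=> Kq n _; exists q, (0, 0); split => //; split.
      by split => /=; rewrite normr0 invr_ge0.
    by rewrite !addr0 -surjective_pairing.
  move=> h; apply: (compact_closed2 cK) => B /nbhs_ballP[d /= d0 dB].
  have [n nd] := ex_invS_lt d0.
  have [p [b [Kp [[b1 b2] qE]]]] := h n I.
  exists p; split => //; apply: dB; rewrite qE.
  split => /=; rewrite /ball /= addrAC subrr add0r.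
    exact: le_lt_trans nd.
  exact: le_lt_trans nd.
have := @nonincreasing_cvg_mu _ _ _ mu F (mu_lty (cF 0%N))
  (fun n => compact_measurable2 (cF n)).
rewrite FK => /(_ (compact_measurable2 cK)) cvgF.
have {cvgF}/fine_cvgP[_] : (mu \o F @ \oo --> (vol2 K)%:E)%E.
  rewrite vol2E //; apply: cvgF => m n mn; apply/subsetPset => p.
  move=> [a [b [Ka [[b1 b2] ->]]]]; exists a, b; split => //; split => //.
  have mn1 : n.+1%:R^-1 <= m.+1%:R^-1 :> R by rewrite lef_pV2 ?posrE ?ler_nat.
  by split; apply: le_trans mn1.
move=> /cvgrPdist_lt /(_ e e0)[n _ /(_ n (leqnn n))] /= h.
exists n.+1%:R^-1; first by rewrite invr_gt0.
move=> L cL KL LF; apply/andP; split; first exact: vol2_le.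
apply: le_lt_trans (vol2_le cL (cF n) LF) _.
move: h; rewrite ltr_distl => /andP[h _].
by rewrite -ltrBlDr.
Qed.

End Volume.

(** * Vertical sections *)

Section Sections.
Variable R : realType.
Implicit Types (K L A B : set (R * R)) (p q : R * R).

Notation lam := (@lebesgue_measure R).
Notation mu := (lam \x lam)%E.

Lemma lam_itvcc (c d : R) : c <= d ->
  lam [set y | c <= y <= d] = (d - c)%:E.
Proof.
move=> cd; have -> : [set y | c <= y <= d] = `[c, d]%classic.
  by apply/seteqP; split => y; rewrite /= in_itv.
rewrite lebesgue_measure_itv /= lte_fin; case: ltgtP cd => // -> _.
by rewrite subrr.
Qed.

Lemma compact_convex_itv (A : set R) (a : R) : compact A -> A a ->
  (forall x y t, A x -> A y -> 0 <= t <= 1 -> A (t * x + (1 - t) * y)) ->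
  exists c d, c <= d /\ forall y, A y <-> c <= y <= d.
Proof.
move=> cA Aa convA; have A0 : A !=set0 by exists a.
have idc : {within A, continuous (@idfun R)}.
  by apply: continuous_subspaceT => x; exact: cvg_id.
have [d Ad dmax] := compact_EVT_max A0 cA idc.
have [c Ac cmin] := compact_EVT_min A0 cA idc.
move: Ad Ac => /set_mem Ad /set_mem Ac.
have cd : c <= d by apply: (dmax c); exact/mem_set.
exists c, d; split => // y; split.
  by move=> Ay; rewrite (cmin y) ?(dmax y) //; exact/mem_set.
move=> /andP[cy yd]; have [e|ne] := eqVneq c d.
  by have -> : y = c by lra.
have dc : 0 < d - c by rewrite subr_gt0 lt_neqAle ne.
have -> : y = (d - y) / (d - c) * c + (1 - (d - y) / (d - c)) * d.
  by field; rewrite gt_eqF.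
apply: convA => //; rewrite divr_ge0 ?subr_ge0 //= ler_pdivrMr //.
by rewrite mul1r lerD2l lerN2.
Qed.

Lemma section_itv K x y0 : compact K -> convex_set2 K -> K (x, y0) ->
  exists c d, c <= d /\ forall y, K (x, y) <-> c <= y <= d.
Proof.
move=> cK convK Kxy.
pose A := [set y | K (x, y)].
have cA : compact A.
  have -> : A = snd @` (K `&` fst @^-1` [set x]).
    apply/seteqP; split => [y Ky|y [[a b] [Kab /= ax] <-]]; first by exists (x, y).
    by rewrite /A /= -ax.
  apply: compact_image; first exact: snd_continuous.
  apply: compact_preimage (@fst_continuous R) _ cK.
  exact: closed_eq.
apply: compact_convex_itv (cA) Kxy _ => u v t Ku Kv t01.
have := convK _ _ t Ku Kv t01 => /=.
by rewrite (_ : t * x + (1 - t) * x = x) //; ring.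
Qed.

Lemma xsection_mem K x : xsection K x = [set y | K (x, y)].
Proof. by apply/seteqP; split => y; rewrite /xsection /= inE. Qed.

(** Cavalieri's principle: over each [x] the section of [L] is a translated or reflected copy of an
    interval, of the same length. Letting [c] depend on [x] covers shears as well as
    translations. *)
Lemma vol2_vertical_affine K L (s : R) (c : R -> R) : compact K -> convex_set2 K ->
  s = 1 \/ s = -1 -> (forall x y, L (x, y) <-> K (x, s * y + c x)) ->
  vol2 L = vol2 K.
Proof.
move=> cK convK s1 LK; apply: eq_vol2_xsection => x; rewrite !xsection_mem.
have [[y0 Ky0]|nK] := pselect (exists y, K (x, y)); last first.
  congr (lam _); apply/seteqP; split => y /=.
    by move=> /LK Ky; case: nK; eexists; exact: Ky.
  by move=> Ky; case: nK; exists y.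
have [a [b [ab KE]]] := section_itv cK convK Ky0.
rewrite (_ : [set y | K (x, y)] = [set y | a <= y <= b]); last first.
  by apply/seteqP; split => y /= /KE.
rewrite lam_itvcc //; case: s1 => s1; rewrite {}s1 in LK.
  rewrite (_ : [set y | L (x, y)] = [set y | a - c x <= y <= b - c x]).
    by rewrite lam_itvcc; [congr EFin; ring|rewrite lerD2r].
  apply/seteqP; split => y /=.
    by move=> /LK/KE; rewrite mul1r => /andP[h1 h2]; apply/andP; split; lra.
  by move=> /andP[h1 h2]; apply/LK/KE; apply/andP; split; lra.
rewrite (_ : [set y | L (x, y)] = [set y | c x - b <= y <= c x - a]).
  by rewrite lam_itvcc; [congr EFin; ring|rewrite lerD2l lerN2].
apply/seteqP; split => y /=.
  by move=> /LK/KE/andP[h1 h2]; apply/andP; split; lra.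
by move=> /andP[h1 h2]; apply/LK/KE; apply/andP; split; lra.
Qed.

Definition segment0 p : set (R * R) :=
  [set q | exists2 t, 0 <= t <= 1 & q = (t * p.1, t * p.2)].

(** The Minkowski sum of an interval and the segment from 0 to [s]; the minimum and the maximum with
    0 treat both signs of [s] at once. *)
Lemma itv_add_segment (c d s y : R) : c <= d ->
  (c + Num.min s 0 <= y <= d + Num.max s 0) <->
  exists2 t, 0 <= t <= 1 & c <= y - t * s <= d.
Proof.
move=> cd; split; last first.
  move=> [t /andP[t0 t1] /andP[h1 h2]].
  have [s0|s0] := leP 0 s.
    have ts0 : 0 <= t * s by rewrite mulr_ge0.
    have ts1 : t * s <= s by rewrite ler_piMl.
    by rewrite ?min_r ?max_l ?addr0 //; apply/andP; split; lra.
  have ts0 : t * s <= 0 by rewrite mulr_ge0_le0 // ltW.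
  have ts1 : s <= t * s by rewrite ler_niMl // ltW.
  by rewrite ?(min_l (ltW s0)) ?(max_r (ltW s0)) ?addr0; apply/andP; split; lra.
have [s0|s0] := leP 0 s.
  rewrite addr0 => /andP[h1 h2].
  have [yd|dy] := leP y d.
    by exists 0; rewrite ?lexx ?ler01 // mul0r subr0 h1 yd.
  have s1 : 0 < s by lra.
  exists ((y - d) / s).
    by rewrite divr_ge0 ?ler_pdivrMr /=; lra.
  by rewrite divfK ?gt_eqF //; apply/andP; split; lra.
rewrite addr0 => /andP[h1 h2].
have [cy|yc] := leP c y.
  by exists 0; rewrite ?lexx ?ler01 // mul0r subr0 cy h2.
exists ((y - c) / s).
  by rewrite ler_ndivrMr // mulr_le0 ?invr_le0; [lra|lra|exact: ltW].
by rewrite divfK ?lt_eqF //; apply/andP; split; lra.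
Qed.

Lemma min_max_sub (s : R) : Num.max s 0 - Num.min s 0 = `|s|.
Proof.
have [s0|s0] := leP 0 s; first by rewrite subr0 ger0_norm.
by rewrite sub0r ltr0_norm.
Qed.

(** Each nonempty vertical section is an interval and becomes longer by [|s|], while empty sections
    stay empty; integrating the section lengths gives the extra term. *)
Lemma vol2_add_vertical K s : compact K -> convex_set2 K ->
  vol2 (msum (segment0 (0, s)) K) = vol2 K + `|s| * fine (lam (fst @` K)).
Proof.
move=> cK convK.
have cpK : compact (fst @` K) by apply: compact_image => //; exact: fst_continuous.
have mpK : measurable (fst @` K) := compact_measurable cpK.
have fpK : lam (fst @` K) \is a fin_num.
  by rewrite ge0_fin_numE ?compact_finite_measure.
have E x : lam (xsection (msum (segment0 (0, s)) K) x) =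
    (lam (xsection K x) + (`|s| * \1_(fst @` K) x)%:E)%E.
  rewrite !xsection_mem; have [[y0 Ky0]|nK] := pselect (exists y, K (x, y)).
    have [a [b [ab KE]]] := section_itv cK convK Ky0.
    rewrite (_ : [set y | K (x, y)] = [set y | a <= y <= b]); last first.
      by apply/seteqP; split => y /= /KE.
    rewrite (_ : [set y | msum _ _ _] =
      [set y | a + Num.min s 0 <= y <= b + Num.max s 0]).
      rewrite indicE mem_set /=; last by exists (x, y0).
      rewrite mulr1 !lam_itvcc //; first by rewrite -min_max_sub -EFinD; congr EFin; ring.
      have : 0 <= `|s| by []. by rewrite -min_max_sub; lra.
    apply/seteqP; split => y /=.
      move=> [_ [[u v] [[t t01 ->] [Kuv [/= xE yE]]]]].
      apply/itv_add_segment => //; exists t => //; apply/KE.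
      move: Kuv; rewrite xE yE mulr0 add0r; congr (K (_, _)); ring.
    move/itv_add_segment => /(_ ab)[t t01 /KE Ky].
    exists (0, t * s), (x, y - t * s); split.
      by exists t => //; rewrite mulr0.
    by split => //; congr (_, _); rewrite /= ?add0r //; ring.
  rewrite (_ : [set y | msum _ _ _] = set0); last first.
    apply/seteqP; split => y //= [_ [[u v] [[t t01 ->] [Kuv [/= xE yE]]]]].
    by case: nK; exists v; rewrite xE mulr0 add0r.
  rewrite (_ : [set y | K _] = set0); last first.
    by apply/seteqP; split => y //= Ky; case: nK; exists y.
  rewrite indicE memNset; first by rewrite mulr0 measure0 adde0.
  by move=> [[u v] Kuv /= uE]; case: nK; exists v; rewrite -uE.
rewrite {1}/vol2 (_ : mu (msum _ _) = \int[lam]_x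
  (lam (xsection K x) + (`|s| * \1_(fst @` K) x)%:E))%E; last first.
  by apply: eq_integral => x _; exact: E.
rewrite ge0_integralD //=; last 2 first.
- exact: (@measurable_fun_xsection _ _ _ _ R lam K (compact_measurable2 cK)).
- by apply/measurable_EFinP; apply: measurable_funM.
rewrite (_ : \int[lam]_x (`|s| * \1_(fst @` K) x)%:E = `|s|%:E * lam (fst @` K))%E.
  rewrite fineD; [|exact: mu_fin_num|by rewrite fin_numM].
  by rewrite fineM.
under eq_integral do rewrite EFinM.
rewrite ge0_integralZl //.
  by rewrite integral_indic // setIT.
exact: measurableT_comp.
Qed.

End Sections.

(** * Zonotopes *)

Section Zonotopes.
Variable R : realType.
Implicit Types (K L A B : set (R * R)) (p q u v : R * R) (E F : seq (R * R)).

Notation lam := (@lebesgue_measure R).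

Lemma msumC K L : msum K L = msum L K.
Proof.
apply/seteqP; split => p [a [b [Ka [Lb ->]]]]; exists b, a; do 2!split => //;
  by rewrite addrC [a.2 + _]addrC.
Qed.

Lemma msumA K L A : msum K (msum L A) = msum (msum K L) A.
Proof.
apply/seteqP; split => p.
  move=> [a [_ [Ka [[b [c [Lb [Ac ->]]]] ->]]]].
  exists (a.1 + b.1, a.2 + b.2), c; split; first by exists a, b.
  by rewrite /= !addrA.
move=> [_ [c [[a [b [Ka [Lb ->]]]] [Ac ->]]]].
exists a, (b.1 + c.1, b.2 + c.2); split => //; split; first by exists b, c.
by rewrite /= !addrA.
Qed.

Lemma msum0 K : msum [set (0, 0)] K = K.
Proof.
apply/seteqP; split => [p [a [b [-> [Kb ->]]]]|p Kp].
  by rewrite /= !add0r -surjective_pairing.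
by exists (0, 0), p; rewrite /= !add0r -surjective_pairing.
Qed.

Lemma convex_msum K L : convex_set2 K -> convex_set2 L -> convex_set2 (msum K L).
Proof.
move=> cK cL _ _ t [a [b [Ka [Lb ->]]]] [a' [b' [Ka' [Lb' ->]]]] t01.
exists (t * a.1 + (1 - t) * a'.1, t * a.2 + (1 - t) * a'.2),
  (t * b.1 + (1 - t) * b'.1, t * b.2 + (1 - t) * b'.2).
split; first exact: cK.
split; first exact: cL.
by congr (_, _) => /=; ring.
Qed.

Lemma convex_segment0 p : convex_set2 (segment0 p).
Proof.
move=> _ _ t [s s01 ->] [r r01 ->] t01; exists (t * s + (1 - t) * r).
  move: s01 r01 t01 => /andP[? ?] /andP[? ?] /andP[? ?].
  by apply/andP; split; nra.
by congr (_, _) => /=; ring.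
Qed.

Lemma compact_segment0 p : compact (segment0 p).
Proof.
have -> : segment0 p = (fun t : R => (t * p.1, t * p.2)) @` `[0, 1].
  apply/seteqP; split => q.
    by move=> [t t01 ->]; exists t => //=; rewrite in_itv.
  by move=> [t /=]; rewrite in_itv /= => t01 <-; exists t.
apply: compact_image; last exact: segment_compact.
move=> t; apply: (@cvg_pair _ _ _ _ (nbhs (t * p.1)) (nbhs (t * p.2))).
  by apply: cvgM; [exact: cvg_id|exact: cvg_cst].
by apply: cvgM; [exact: cvg_id|exact: cvg_cst].
Qed.

Fixpoint zonotope E : set (R * R) :=
  if E is v :: E' then msum (segment0 v) (zonotope E') else [set (0, 0)].

Definition vsum E : R * R := (\sum_(v <- E) v.1, \sum_(v <- E) v.2).

Lemma zonotope_cat E F : zonotope (E ++ F) = msum (zonotope E) (zonotope F).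
Proof.
by elim: E => [|v E IH] /=; rewrite ?msum0 // IH msumA.
Qed.

Lemma vsum_cat E F : vsum (E ++ F) = ((vsum E).1 + (vsum F).1, (vsum E).2 + (vsum F).2).
Proof. by rewrite /vsum !big_cat. Qed.

Lemma vsum_cons v E : vsum (v :: E) = (v.1 + (vsum E).1, v.2 + (vsum E).2).
Proof. by rewrite /vsum !big_cons. Qed.

Lemma convex_zonotope E : convex_set2 (zonotope E).
Proof.
elim: E => [|v E IH] /=; last exact: convex_msum (@convex_segment0 v) IH.
by move=> _ _ t -> -> _ /=; congr (_, _); ring.
Qed.

Lemma compact_zonotope E : compact (zonotope E).
Proof.
elim: E => [|v E IH] /=; first exact: (@compact_set1 (R * R)%type).
by apply: compact_msum => //; exact: compact_segment0.
Qed.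

Lemma zonotope0 E : zonotope E (0, 0).
Proof.
elim: E => [|v E IH] //=; exists (0, 0), (0, 0); rewrite /= !addr0; split=> //.
by exists 0; rewrite ?lexx ?ler01 // !mul0r.
Qed.

(** Central symmetry about half the edge sum: every parameter [t] is replaced by [1 - t]. *)
Lemma zonotope_sub E p : zonotope E p ->
  zonotope E ((vsum E).1 - p.1, (vsum E).2 - p.2).
Proof.
elim: E p => [|v E IH] p /=.
  by move=> ->; rewrite /vsum !big_nil /= subr0.
move=> [_ [b [[t t01 ->] [Eb ->]]]].
exists ((1 - t) * v.1, (1 - t) * v.2), ((vsum E).1 - b.1, (vsum E).2 - b.2).
split; first by exists (1 - t) => //; move: t01 => /andP[? ?]; apply/andP; split; lra.
split; first exact: IH.
by rewrite /vsum !big_cons; congr (_, _) => /=; ring.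
Qed.

Lemma zonotope_vsum E : zonotope E (vsum E).
Proof.
by have := zonotope_sub (zonotope0 E); rewrite !subr0.
Qed.

Lemma zonotope_image (f : R * R -> R * R) E :
  f (0, 0) = (0, 0) ->
  (forall p q, f (p.1 + q.1, p.2 + q.2) = ((f p).1 + (f q).1, (f p).2 + (f q).2)) ->
  (forall t p, f (t * p.1, t * p.2) = (t * (f p).1, t * (f p).2)) ->
  zonotope (map f E) = f @` zonotope E.
Proof.
move=> f0 fD fZ; elim: E => [|v E IH] /=.
  by rewrite image_set1 f0.
rewrite IH; apply/seteqP; split => p.
  move=> [_ [_ [[t t01 ->] [[b Eb <-] ->]]]].
  exists (t * v.1 + b.1, t * v.2 + b.2).
    by exists (t * v.1, t * v.2), b; split => //; exists t.
  by rewrite (fD (t * v.1, t * v.2)) fZ.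
move=> [_ [_ [b [[t t01 ->] [Eb ->]]]] <-].
rewrite fD fZ; exists (t * (f v).1, t * (f v).2), (f b).
by split; [exists t|split => //; exists b].
Qed.

Lemma zonotope_fst E x : (fst @` zonotope E) x <->
  \sum_(v <- E) Num.min v.1 0 <= x <= \sum_(v <- E) Num.max v.1 0.
Proof.
elim: E x => [|v E IH] x.
  rewrite !big_nil -eq_le eq_sym; split => [[_ /= -> <-]//|/eqP ->].
  by exists (0, 0).
rewrite !big_cons [Num.min _ _ + _]addrC [Num.max _ _ + _]addrC.
rewrite itv_add_segment; last first.
  apply: ler_sum => u _; rewrite -subr_ge0; by rewrite min_max_sub.
split.
  move=> [_ /= [_ [b [[t t01 ->] [Eb ->]]]] <-] /=; exists t => //.
  by apply/IH; exists b => //; rewrite addrC addKr.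
move=> [t t01 /IH[b Eb bE]]; exists (t * v.1 + b.1, t * v.2 + b.2).
  by exists (t * v.1, t * v.2), b; split => //; exists t.
by rewrite /= bE addrC subrK.
Qed.

Lemma lam_zonotope_fst E : fine (lam (fst @` zonotope E)) = \sum_(v <- E) `|v.1|.
Proof.
rewrite (_ : fst @` _ =
  [set x | \sum_(v <- E) Num.min v.1 0 <= x <= \sum_(v <- E) Num.max v.1 0]).
  rewrite lam_itvcc /=.
    by rewrite -sumrB; apply: eq_bigr => v _; exact: min_max_sub.
  by apply: ler_sum => u _; rewrite -subr_ge0 min_max_sub.
by apply/seteqP; split => x /zonotope_fst.
Qed.

Lemma vol2_zonotope_vertical s E :
  vol2 (zonotope ((0, s) :: E)) = vol2 (zonotope E) + `|s| * \sum_(v <- E) `|v.1|.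
Proof.
rewrite /= vol2_add_vertical ?lam_zonotope_fst //.
  exact: compact_zonotope.
exact: convex_zonotope.
Qed.

Definition shear (k : R) p : R * R := (p.1, p.2 - k * p.1).

Lemma zonotope_shear k E : zonotope (map (shear k) E) = shear k @` zonotope E.
Proof.
by apply: zonotope_image => [|p q|t p]; rewrite /shear /=; congr (_, _); ring.
Qed.

Lemma zonotope_swap E : zonotope (map (@swap2 R) E) = @swap2 R @` zonotope E.
Proof. by apply: zonotope_image. Qed.

Lemma vol2_zonotope_shear k E :
  vol2 (zonotope (map (shear k) E)) = vol2 (zonotope E).
Proof.
rewrite zonotope_shear.
apply: (@vol2_vertical_affine R (zonotope E) _ 1 (fun x => k * x)).
- exact: compact_zonotope.
- exact: convex_zonotope.
- by left.
move=> x y; rewrite mul1r; split.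
  by move=> [[a b] Eab [<- <-]] /=; rewrite subrK.
by move=> Exy; exists (x, y + k * x) => //; rewrite /shear /= addrK.
Qed.

Lemma vol2_zonotope_swap E :
  vol2 (zonotope (map (@swap2 R) E)) = vol2 (zonotope E).
Proof. by rewrite zonotope_swap vol2_swap //; exact: compact_zonotope. Qed.

Definition det2 u v : R := u.1 * v.2 - u.2 * v.1.

Fixpoint zonotope_area E : R :=
  if E is v :: E' then zonotope_area E' + \sum_(u <- E') `|det2 v u| else 0.

(** The classical area formula, a sum over unordered pairs of generators. By induction, a vertical
    first edge is handled by [vol2_zonotope_vertical]; any other edge is made horizontal by the
    shear along its slope [k] and then vertical by the swap, which preserve areas of zonotopes and
    absolute values of determinants. *)
Lemma vol2_zonotope E : vol2 (zonotope E) = zonotope_area E.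
Proof.
elim: E => [|v E IH].
  rewrite /vol2 (_ : (_ \x _)%E _ = 0%E) //; apply: integral0_eq => x _ /=.
  rewrite xsection_mem (_ : [set y | _] = if x == 0 then [set 0] else set0).
    by case: eqP => _; rewrite ?lebesgue_measure_set1 ?measure0.
  apply/seteqP; split => y /=; case: eqP => [->|ne] //.
  - by move=> [].
  - by move=> [/ne].
  - by move=> ->.
have [v0|v0] := eqVneq v.1 0.
  rewrite [v]surjective_pairing v0 vol2_zonotope_vertical IH /=; congr (_ + _).
  rewrite mulr_sumr; apply: eq_bigr => u _.
  by rewrite /det2 /= mul0r sub0r normrN normrM.
pose k := v.2 / v.1.
rewrite -(vol2_zonotope_shear k) -vol2_zonotope_swap /=.
rewrite (_ : swap2 (shear k v) = (0, v.1)); last first.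
  by rewrite /swap2 /shear /k /= divfK // subrr.
have := vol2_zonotope_vertical v.1 (map (@swap2 R) (map (shear k) E)).
rewrite /= => ->; rewrite vol2_zonotope_swap vol2_zonotope_shear IH; congr (_ + _).
rewrite !big_map mulr_sumr; apply: eq_bigr => u _.
rewrite -normrM /det2 /=; congr (`|_|); rewrite /k; field; exact: v0.
Qed.

Lemma zonotope_area_cat E F : zonotope_area (E ++ F) =
  zonotope_area E + zonotope_area F + \sum_(u <- E) \sum_(v <- F) `|det2 u v|.
Proof.
elim: E => [|u E IH] /=; first by rewrite big_nil; lra.
by rewrite IH big_cat big_cons /=; ring.
Qed.

End Zonotopes.

(** * Polygons *)

Section Polygons.
Variable R : realType.
Implicit Types (K L A B : set (R * R)) (p q u v : R * R) (E F : seq (R * R)).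

Notation lam := (@lebesgue_measure R).
Notation mu := (lam \x lam)%E.

(** A translation or point reflection is performed one coordinate at a time: a vertical map, an
    exchange of coordinates, a vertical map again, and the exchange back. *)
Lemma vol2_affine K L (s : R) p : compact K -> convex_set2 K ->
  s = 1 \/ s = -1 -> (forall q, L q <-> K (s * q.1 + p.1, s * q.2 + p.2)) ->
  vol2 L = vol2 K.
Proof.
move=> cK convK s1 LK.
have ss : s * s = 1 by case: s1 => ->; ring.
pose f q := (q.1, s * (q.2 - p.2)); pose K1 := f @` K.
have K1E x y : K1 (x, y) <-> K (x, s * y + p.2).
  split=> [[[a b] Kab [<- <-]]|Kxy].
    by rewrite /= mulrA ss mul1r subrK.
  by exists (x, s * y + p.2) => //; rewrite /f /= addrK mulrA ss mul1r.
have cK1 : compact K1.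
  apply: compact_image cK => q.
  apply: (@cvg_pair _ _ _ _ (nbhs q.1) (nbhs (s * (q.2 - p.2)))).
    exact: fst_continuous.
  apply: cvgM; first exact: cvg_cst.
  by apply: cvgB; [exact: snd_continuous|exact: cvg_cst].
have convK1 : convex_set2 K1.
  move=> [a1 a2] [b1 b2] t /K1E Ka /K1E Kb t01; apply/K1E => /=.
  have := convK _ _ t Ka Kb t01; rewrite /=; congr (K (_, _)); ring.
have v1 : vol2 K1 = vol2 K.
  exact: (vol2_vertical_affine (c := fun=> p.2) cK convK s1 K1E).
pose K2 := @swap2 R @` K1.
have K2E x y : K2 (x, y) <-> K1 (y, x).
  by split=> [[[a b] Kab [<- <-]]|]; [|exists (y, x)].
have cK2 : compact K2 by apply: compact_image => //; exact: swap2_continuous.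
have convK2 : convex_set2 K2.
  move=> [a1 a2] [b1 b2] t /K2E Ka /K2E Kb t01; apply/K2E => /=.
  exact: (convK1 _ _ t Ka Kb t01).
have v2 : vol2 K2 = vol2 K1 by exact: vol2_swap.
pose L' := @swap2 R @` L.
have L'E x y : L' (x, y) <-> K2 (x, s * y + p.1).
  split=> [[[a b] /LK Kab [<- <-]]|/K2E/K1E Kxy]; first by apply/K2E/K1E.
  by exists (y, x) => //; apply/LK.
have v3 : vol2 L' = vol2 K2.
  exact: (vol2_vertical_affine (c := fun=> p.1) cK2 convK2 s1 L'E).
rewrite -v1 -v2 -v3 vol2_swap //.
(* The inverse of the affine map, as [s * s = 1]; it exhibits [L] as a continuous image of [K],
   hence compact, as the last exchange of coordinates requires. *)
pose g q := (s * (q.1 - p.1), s * (q.2 - p.2)).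
have -> : L = g @` K.
  apply/seteqP; split => [q /LK Kq|_ [q Kq <-]].
    exists (s * q.1 + p.1, s * q.2 + p.2) => //.
    by rewrite /g /= !addrK !mulrA ss !mul1r -surjective_pairing.
  by apply/LK; rewrite /g /= !mulrA ss !mul1r !subrK -surjective_pairing.
apply: compact_image cK => q.
apply: (@cvg_pair _ _ _ _ (nbhs (s * (q.1 - p.1))) (nbhs (s * (q.2 - p.2)))).
  apply: cvgM; first exact: cvg_cst.
  by apply: cvgB; [exact: fst_continuous|exact: cvg_cst].
apply: cvgM; first exact: cvg_cst.
by apply: cvgB; [exact: snd_continuous|exact: cvg_cst].
Qed.

Lemma det2_continuous u : continuous (det2 u).
Proof.
move=> q; apply: cvgB.
  by apply: cvgM; [exact: cvg_cst|exact: snd_continuous].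
by apply: cvgM; [exact: cvg_cst|exact: fst_continuous].
Qed.

Lemma compact_half_ge u K : compact K -> compact (K `&` [set q | 0 <= det2 u q]).
Proof.
by move=> cK; apply: (compact_preimage (@det2_continuous u) (@closed_ge R 0) cK).
Qed.

Lemma compact_half_le u K : compact K -> compact (K `&` [set q | det2 u q <= 0]).
Proof.
by move=> cK; apply: (compact_preimage (@det2_continuous u) (@closed_le R 0) cK).
Qed.

(** The overlap lies on the line spanned by [u]. This line is not vertical, so its vertical sections
    are single points and the overlap is a null set. *)
Lemma vol2_halves u A B : 0 < u.1 -> compact A -> compact B ->
  A `<=` [set q | 0 <= det2 u q] -> B `<=` [set q | det2 u q <= 0] ->
  vol2 (A `|` B) = vol2 A + vol2 B.
Proof.
move=> u0 cA cB sA sB.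
have mA := compact_measurable2 cA; have mB := compact_measurable2 cB.
have AB0 : mu (A `&` B) = 0%E.
  apply: integral0_eq => x _ /=.
  apply/eqP; rewrite -measure_le0.
  rewrite -(lebesgue_measure_set1 (u.2 * x / u.1)); apply: le_measure.
  - by rewrite inE; apply: measurable_xsection; exact: measurableI.
  - by rewrite inE.
  rewrite xsection_mem => y /= [/sA /= h2 /sB /= h1].
  have : det2 u (x, y) = 0 by apply/eqP; rewrite eq_le h1 h2.
  by rewrite /det2 /= => h; rewrite -[y](mulfK (lt0r_neq0 u0)); congr (_ / _); lra.
rewrite {1}/vol2 (_ : mu (A `|` B) = mu A + mu B)%E.
  by rewrite fineD //; exact: mu_fin_num.
have := @measureUfinl _ _ R mu A B mA mB (mu_lty cA).
by rewrite /= AB0 sube0.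
Qed.

Lemma convex_half_ge u K : convex_set2 K ->
  convex_set2 (K `&` [set q | 0 <= det2 u q]).
Proof.
move=> cK a b t [Ka ha] [Kb hb] t01; split; first exact: cK.
rewrite /= (_ : det2 _ _ = t * det2 u a + (1 - t) * det2 u b); last first.
  by rewrite /det2 /=; ring.
move: t01 => /andP[t0 t1]; rewrite addr_ge0 // mulr_ge0 //; lra.
Qed.

(** The central symmetry of the zonotope exchanges the two sides of the chord from 0 to [vsum E], so
    both halves have the same area. *)
Lemma vol2_zonotope_half E : 0 < (vsum E).1 ->
  vol2 (zonotope E `&` [set q | 0 <= det2 (vsum E) q]) = zonotope_area E / 2 /\
  vol2 (zonotope E `&` [set q | det2 (vsum E) q <= 0]) = zonotope_area E / 2.
Proof.
move=> W0; set S := vsum E; set H1 := _ `&` _; set H2 := _ `&` _.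
have cH1 : compact H1 by apply: compact_half_ge; exact: compact_zonotope.
have cH2 : compact H2 by apply: compact_half_le; exact: compact_zonotope.
have v12 : vol2 H2 = vol2 H1.
  apply: (@vol2_affine H1 H2 (-1) S) => //.
  - by apply: convex_half_ge; exact: convex_zonotope.
  - by right.
  move=> q; rewrite !mulN1r ![- _ + _]addrC.
  have e r : det2 S (S.1 - r.1, S.2 - r.2) = - det2 S r by rewrite /det2 /=; ring.
  split=> -[Eq hq]; split => /=.
  - exact: zonotope_sub.
  - by rewrite e oppr_ge0.
  - have := zonotope_sub Eq; rewrite /= !opprB ![_ + (_ - _)]addrC !subrK.
    by rewrite -surjective_pairing.
  - by move: hq; rewrite /= e oppr_ge0.
have := vol2_zonotope E.
have -> : zonotope E = H1 `|` H2.
  apply/seteqP; split => [q Eq|q [[]//|[]//]].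
  by have [h|h] := leP 0 (det2 S q); [left|right; split => //; exact: ltW].
rewrite (@vol2_halves S) //; [|by move=> q []|by move=> q []].
by rewrite v12 => h; split; lra.
Qed.

(* [E] and [F] list the edges of the upper and of the lower boundary chain, both
   traversed from left to right; the order of the edges is irrelevant. *)
Definition polygon E F : set (R * R) := [set p |
  (exists2 c, 0 <= c & zonotope E (p.1, p.2 + c)) /\
  (exists2 c, 0 <= c & zonotope F (p.1, p.2 - c))].

(** Nonnegative first coordinates allow vertical edges, which occur at the two ends of a polygon. *)
Definition chains E F :=
  [/\ forall v, v \in E -> 0 <= v.1, forall v, v \in F -> 0 <= v.1 & vsum E = vsum F].

Lemma chains_cat E F E' F' : chains E F -> chains E' F' -> chains (E ++ E') (F ++ F').
Proof.
move=> [h1 h2 h3] [k1 k2 k3]; split.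
- by move=> v; rewrite mem_cat => /orP[/h1|/k1].
- by move=> v; rewrite mem_cat => /orP[/h2|/k2].
- by rewrite !vsum_cat h3 k3.
Qed.

Lemma zonotope_fst_bound E p : (forall v, v \in E -> 0 <= v.1) -> zonotope E p ->
  0 <= p.1 <= (vsum E).1.
Proof.
move=> E0 Ep.
have /zonotope_fst : (fst @` zonotope E) p.1 by exists p.
have -> : \sum_(v <- E) Num.min v.1 0 = 0.
  by rewrite big_seq big1 // => v /E0 v0; rewrite min_r.
have -> // : \sum_(v <- E) Num.max v.1 0 = (vsum E).1.
by apply: eq_big_seq => v /E0 v0; rewrite max_l.
Qed.

Lemma zonotope_chord E t : 0 <= t <= 1 ->
  zonotope E (t * (vsum E).1, t * (vsum E).2).
Proof.
move=> t01; have := convex_zonotope (zonotope_vsum E) (zonotope0 E) t01.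
by rewrite /= !mulr0 !addr0.
Qed.

(** The chord from 0 to the common edge sum lies in both zonotopes; the point in question is the one
    of the chord over [x]. *)
Lemma polygon_chord E F x : chains E F -> 0 <= x <= (vsum E).1 ->
  exists y, [/\ zonotope E (x, y), zonotope F (x, y) & det2 (vsum E) (x, y) = 0].
Proof.
move=> [_ _ SEF] /andP[x0 xS].
have [t t01 tx] : exists2 t, 0 <= t <= 1 & t * (vsum E).1 = x.
  have [S0|S0] := eqVneq (vsum E).1 0.
    by exists 0; [rewrite lexx ler01|rewrite mul0r; lra].
  have S1 : 0 < (vsum E).1 by rewrite lt_neqAle eq_sym S0 (le_trans x0).
  exists (x / (vsum E).1); last by rewrite divfK.
  by rewrite divr_ge0 ?(ltW S1) //= ler_pdivrMr // mul1r.
exists (t * (vsum E).2); rewrite -tx; split.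
- exact: zonotope_chord.
- by rewrite SEF; exact: zonotope_chord.
- by rewrite /det2 /=; ring.
Qed.

(** If [p] is on or above the chord, it belongs to the polygon itself; otherwise the point of the
    chord over it does. *)
Lemma polygon_above E F p : chains E F -> zonotope E p ->
  exists2 y, p.2 <= y & polygon E F (p.1, y).
Proof.
move=> EF Ep; have [E0 _ _] := EF.
have [y [Ey Fy _]] := polygon_chord EF (zonotope_fst_bound E0 Ep).
have [yp|py] := leP y p.2.
  exists p.2 => //; split => /=.
    by exists 0 => //; rewrite addr0 -surjective_pairing.
  by exists (p.2 - y); [rewrite subr_ge0|rewrite subKr].
exists y; first exact: ltW.
by split; exists 0; rewrite ?addr0 ?subr0.
Qed.

Lemma polygon_below E F p : chains E F -> zonotope F p ->
  exists2 y, y <= p.2 & polygon E F (p.1, y).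
Proof.
move=> EF Fp; have [_ F0 SEF] := EF.
have := zonotope_fst_bound F0 Fp; rewrite -SEF => /(polygon_chord EF)[y [Ey Fy _]].
have [py|yp] := leP p.2 y.
  exists p.2 => //; split => /=.
    by exists (y - p.2); [rewrite subr_ge0|rewrite addrC subrK].
  by exists 0 => //; rewrite subr0 -surjective_pairing.
exists y; first exact: ltW.
by split; exists 0; rewrite ?addr0 ?subr0.
Qed.

Lemma convex_polygon E F : convex_set2 (polygon E F).
Proof.
move=> a b t [[c1 c10 Ea] [c2 c20 Fa]] [[d1 d10 Eb] [d2 d20 Fb]] t01.
have /andP[t0 t1] := t01.
split.
  exists (t * c1 + (1 - t) * d1).
    by rewrite addr_ge0 // mulr_ge0 //; lra.
  have := convex_zonotope Ea Eb t01; congr (zonotope E (_, _)) => /=; ring.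
exists (t * c2 + (1 - t) * d2).
  by rewrite addr_ge0 // mulr_ge0 //; lra.
have := convex_zonotope Fa Fb t01; congr (zonotope F (_, _)) => /=; ring.
Qed.

(* Two points of the Minkowski sum, one above and one below [p], are joined by a
   vertical segment of the Minkowski sum. *)
Lemma msum_polygon E F E' F' : chains E F -> chains E' F' ->
  msum (polygon E F) (polygon E' F') = polygon (E ++ E') (F ++ F').
Proof.
move=> EF EF'; apply/seteqP; split.
  move=> _ [a [b [[[c1 c10 Ea] [c2 c20 Fa]] [[[d1 d10 Eb] [d2 d20 Fb]] ->]]]].
  split; rewrite zonotope_cat.
    exists (c1 + d1); first exact: addr_ge0.
    exists (a.1, a.2 + c1), (b.1, b.2 + d1); split => //; split => //.
    by congr (_, _) => /=; ring.
  exists (c2 + d2); first exact: addr_ge0.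
  exists (a.1, a.2 - c2), (b.1, b.2 - d2); split => //; split => //.
  by congr (_, _) => /=; ring.
move=> p [[c c0]]; rewrite zonotope_cat => -[a [b [Ea [Eb [ab1 ab2]]]]].
move=> [d d0]; rewrite zonotope_cat => -[a' [b' [Fa [Fb [ab1' ab2']]]]].
have [y1 y1a Py1] := polygon_above EF Ea.
have [y2 y2b Py2] := polygon_above EF' Eb.
have [z1 z1a Pz1] := polygon_below EF Fa.
have [z2 z2b Pz2] := polygon_below EF' Fb.
have [t t01 tE] : exists2 t, 0 <= t <= 1 & t * (y1 + y2) + (1 - t) * (z1 + z2) = p.2.
  have [e|ne] := eqVneq (y1 + y2) (z1 + z2).
    by exists 0; [rewrite lexx ler01|rewrite mul0r subr0 mul1r add0r; lra].
  have pos : 0 < (y1 + y2) - (z1 + z2).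
    by rewrite lt_neqAle eq_sym subr_eq0 ne /=; lra.
  exists ((p.2 - (z1 + z2)) / ((y1 + y2) - (z1 + z2))).
    by rewrite divr_ge0 ?ler_pdivrMr //=; lra.
  by field; rewrite gt_eqF.
exists (t * a.1 + (1 - t) * a'.1, t * y1 + (1 - t) * z1),
  (t * b.1 + (1 - t) * b'.1, t * y2 + (1 - t) * z2).
split; first exact: (convex_polygon Py1 Pz1 t01).
split; first exact: (convex_polygon Py2 Pz2 t01).
rewrite [p]surjective_pairing; congr (_, _) => /=.
  transitivity (t * (a.1 + b.1) + (1 - t) * (a'.1 + b'.1)); last by ring.
  by rewrite -ab1 -ab1'; ring.
by rewrite -tE; ring.
Qed.

Lemma zonotope_between E x y1 y2 y : zonotope E (x, y1) -> zonotope E (x, y2) ->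
  y1 <= y <= y2 -> zonotope E (x, y).
Proof.
move=> E1 E2 /andP[h1 h2].
have [c [d [cd EE]]] := section_itv (@compact_zonotope R E) (@convex_zonotope R E) E1.
by apply/EE; move: E1 E2 => /EE/andP[? ?] /EE/andP[? ?]; apply/andP; split; lra.
Qed.

(** A point of the polygon above the chord lies vertically between the chord and a point of
    [zonotope E], hence in that zonotope; below the chord the same holds with [F]. *)
Lemma polygon_halves E F : chains E F -> 0 < (vsum E).1 ->
  polygon E F = (zonotope E `&` [set q | 0 <= det2 (vsum E) q]) `|`
                (zonotope F `&` [set q | det2 (vsum F) q <= 0]).
Proof.
move=> EF W0; have [E0 F0 SEF] := EF; rewrite -SEF.
(* As the chord goes strictly to the right, the determinant grows with the ordinate, and its sign
   tells on which side of the chord a point lies. *)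
have det_lt x y z : (y <= z) = (det2 (vsum E) (x, y) <= det2 (vsum E) (x, z)).
  by rewrite /det2 /= lerD2r ler_pM2l.
apply/seteqP; split => [[x y] [[c c0 /= Ec] [d d0 /= Fd]]|[x y]].
  have [z [Ez Fz z0]] := polygon_chord EF (zonotope_fst_bound E0 Ec).
  have [zy|yz] := leP z y.
    left; split; last by rewrite /= -z0 -det_lt.
    by apply: zonotope_between Ez Ec _; rewrite zy lerDl.
  right; split; last by rewrite /= -z0 -det_lt ltW.
  by apply: zonotope_between Fd Fz _; apply/andP; split; lra.
move=> [[Ey /= h]|[Fy /= h]].
  have [z [Ez Fz z0]] := polygon_chord EF (zonotope_fst_bound E0 Ey).
  move: h; rewrite -z0 -det_lt => zy.
  split => /=; first by exists 0; rewrite ?addr0.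
  by exists (y - z); rewrite ?subr_ge0 ?subKr.
have := zonotope_fst_bound F0 Fy; rewrite -SEF => /(polygon_chord EF)[z [Ez Fz z0]].
move: h; rewrite -z0 -det_lt => yz.
split => /=; last by exists 0; rewrite ?subr0.
by exists (z - y); rewrite ?subr_ge0 // addrC subrK.
Qed.

Lemma compact_polygon E F : chains E F -> 0 < (vsum E).1 -> compact (polygon E F).
Proof.
move=> EF W0; rewrite polygon_halves //; apply: compactU.
  by apply: compact_half_ge; exact: compact_zonotope.
by apply: compact_half_le; exact: compact_zonotope.
Qed.

Lemma vol2_polygon E F : chains E F -> 0 < (vsum E).1 ->
  vol2 (polygon E F) = (zonotope_area E + zonotope_area F) / 2.
Proof.
move=> EF W0; have [_ _ SEF] := EF; rewrite polygon_halves //.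
rewrite (vol2_halves W0); last 4 first.
- by apply: compact_half_ge; exact: compact_zonotope.
- by apply: compact_half_le; exact: compact_zonotope.
- by move=> q [].
- by move=> q [_]; rewrite SEF.
have [-> _] := vol2_zonotope_half W0.
by rewrite SEF in W0; have [_ ->] := vol2_zonotope_half W0; lra.
Qed.

Definition cross_area E F : R := \sum_(u <- E) \sum_(v <- F) `|det2 u v|.

Definition translate p K := msum [set p] K.

Lemma translateP p K q : translate p K q <-> K (q.1 - p.1, q.2 - p.2).
Proof.
split=> [[_ [b [-> [Kb ->]]]]|Kq].
  by rewrite /= [p.1 + _]addrC [p.2 + _]addrC !addrK -surjective_pairing.
exists p, (q.1 - p.1, q.2 - p.2); split => //; split => //=.
by rewrite addrC subrK [p.2 + _]addrC subrK -surjective_pairing.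
Qed.

Lemma vol2_translate p K : compact K -> convex_set2 K ->
  vol2 (translate p K) = vol2 K.
Proof.
move=> cK convK; apply: (vol2_affine (s := 1) (p := (- p.1, - p.2))) => //.
  by left.
by move=> q; rewrite !mul1r; exact: translateP.
Qed.

Lemma msum_translate p q K L :
  msum (translate p K) (translate q L) = translate (p.1 + q.1, p.2 + q.2) (msum K L).
Proof.
rewrite /translate -msumA [msum K _]msumC -!msumA [msum L K]msumC !msumA.
congr (msum (msum _ _) _); apply/seteqP; split => r.
  by move=> [_ [_ [-> [-> ->]]]].
by move=> ->; exists p, q.
Qed.

(** In the area of the concatenated chains the terms inside each polygon cancel and the cross terms
    remain. One factor 1/2 comes from the area of a polygon, the other from the definition of the
    mixed area. *)
Lemma mixed_area_polygon p q E F E' F' : chains E F -> chains E' F' ->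
  0 < (vsum E).1 -> 0 < (vsum E').1 ->
  mixed_area (translate p (polygon E F)) (translate q (polygon E' F')) =
  (cross_area E E' + cross_area F F') / 4.
Proof.
move=> EF EF' W0 W0'.
have EEFF := chains_cat EF EF'.
have W : 0 < (vsum (E ++ E')).1 by rewrite vsum_cat /= addr_gt0.
rewrite /mixed_area msum_translate msum_polygon // !vol2_translate;
  try exact: convex_polygon; try exact: compact_polygon.
rewrite !vol2_polygon // !zonotope_area_cat /cross_area.
by field.
Qed.

Lemma translate_polygon_body p E F : chains E F -> 0 < (vsum E).1 ->
  convex_body2 (translate p (polygon E F)).
Proof.
move=> EF W0; split; last split.
- have [y _ Py] := polygon_above EF (zonotope0 E).
  by exists (0 + p.1, y + p.2); apply/translateP; rewrite /= !addrK.
- apply: compact_msum; last exact: compact_polygon.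
  exact: (@compact_set1 (R * R)%type).
- apply: convex_msum; last exact: convex_polygon.
  move=> _ _ t -> -> _; rewrite [p]surjective_pairing /=; congr (_, _); ring.
Qed.

End Polygons.

(** * Polygonal approximation *)

Section Approximation.
Variable R : realType.
Implicit Types (K L A B : set (R * R)) (p q u v : R * R) (E F : seq (R * R)).

Definition steps p (s : seq (R * R)) : seq (R * R) :=
  pairmap (fun a b => (b.1 - a.1, b.2 - a.2)) p s.

Definition ltx p q := p.1 < q.1.

Lemma ltx_trans : transitive ltx.
Proof. by move=> q p r; exact: lt_trans. Qed.

Lemma steps_cat p s1 s2 : steps p (s1 ++ s2) = steps p s1 ++ steps (last p s1) s2.
Proof. exact: pairmap_cat. Qed.

Lemma vsum_steps p s : vsum (steps p s) = ((last p s).1 - p.1, (last p s).2 - p.2).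
Proof.
elim: s p => [|q s IH] p /=; first by rewrite /vsum !big_nil !subrr.
by rewrite vsum_cons IH /=; congr (_, _); ring.
Qed.

(** A node is reached by taking the steps before it in full and none of the later ones. *)
Lemma zonotope_steps p s q : q \in p :: s ->
  zonotope (steps p s) (q.1 - p.1, q.2 - p.2).
Proof.
move=> /splitPl[s1 s2 <-]; rewrite steps_cat zonotope_cat.
exists (vsum (steps p s1)), (0, 0); split; first exact: zonotope_vsum.
split; first exact: zonotope0.
by rewrite vsum_steps /= !addr0.
Qed.

Lemma path_last_ge p s q : path ltx p s -> q \in p :: s -> q.1 <= (last p s).1.
Proof.
elim: s p q => [|r s IH] p q /=; first by rewrite inE => _ /eqP ->.
move=> /andP[pr rs]; rewrite inE => /orP[/eqP ->|qs]; last exact: IH.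
by apply: le_trans (IH r r rs (mem_head _ _)); exact: ltW.
Qed.

Lemma path_first_le p s q : path ltx p s -> q \in p :: s -> p.1 <= q.1.
Proof.
move=> ps; rewrite inE => /orP[/eqP -> //|qs].
by apply: ltW; exact: (allP (order_path_min ltx_trans ps)).
Qed.

Lemma mem_steps p s e : path ltx p s -> e \in steps p s -> exists a b,
  [/\ a \in p :: s, b \in p :: s, a.1 < b.1 & e = (b.1 - a.1, b.2 - a.2)].
Proof.
elim: s p => //= q s IH p /andP[pq qs]; rewrite inE => /orP[/eqP ->|es].
  by exists p, q; rewrite !inE !eqxx ?orbT.
have [a [b [ap bp ab ->]]] := IH q qs es.
by exists a, b; split => //; rewrite inE; apply/orP; right.
Qed.

Lemma path_locate p s (x : R) : p.1 <= x <= (last p s).1 ->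
  s = [::] \/ exists s1 q s2, s = s1 ++ q :: s2 /\ (last p s1).1 <= x <= q.1.
Proof.
elim: s p => [|q s IH] p /=; first by left.
move=> /andP[px xl]; right.
have [xq|qx] := leP x q.1; first by exists [::], q, s; rewrite /= px xq.
have [|s0|[s1 [r [s2 [-> h]]]]] := IH q; first by rewrite ltW.
  by move: xl; rewrite s0 /= leNgt qx.
by exists (q :: s1), r, s2.
Qed.

Definition top_point K p := K p /\ forall y, K (p.1, y) -> y <= p.2.

(** The point over [b] of the segment from [a] to [c] lies in [K], so it is not above [b]; the
    inequality of slopes is stated without denominators. *)
Lemma top_point_concave K a b c : convex_set2 K -> K a -> K c -> top_point K b ->
  a.1 < b.1 -> b.1 < c.1 -> (c.2 - b.2) * (b.1 - a.1) <= (b.2 - a.2) * (c.1 - b.1).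
Proof.
move=> convK Ka Kc [Kb bt] ab bc.
have ac : 0 < c.1 - a.1 by lra.
pose t := (c.1 - b.1) / (c.1 - a.1).
have t01 : 0 <= t <= 1 by rewrite divr_ge0 ?ler_pdivrMr //=; lra.
have /bt h : K (b.1, t * a.2 + (1 - t) * c.2).
  have := convK _ _ t Ka Kc t01; congr (K (_, _)).
  by rewrite /t; field; rewrite gt_eqF.
have tE : t * (c.1 - a.1) = c.1 - b.1 by rewrite divfK // gt_eqF.
have := ler_wpM2r (ltW ac) h.
have -> : (t * a.2 + (1 - t) * c.2) * (c.1 - a.1) =
  t * (c.1 - a.1) * (a.2 - c.2) + c.2 * (c.1 - a.1) by ring.
by rewrite tE; lra.
Qed.

(** Slopes decrease along the upper boundary. If [b] and [c] have the same abscissa they coincide;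
    otherwise the slope from [b] to [c] is compared with both others and eliminated, using that its
    width is positive. *)
Lemma top_point_steps K a b c d : convex_set2 K ->
  top_point K a -> top_point K b -> top_point K c -> top_point K d ->
  a.1 < b.1 -> b.1 <= c.1 -> c.1 < d.1 ->
  det2 (b.1 - a.1, b.2 - a.2) (d.1 - c.1, d.2 - c.2) <= 0.
Proof.
move=> convK [Ka ta] [Kb tb] [Kc tc] [Kd td] ab; rewrite le_eqVlt => /orP[/eqP bc|bc] cd.
  have e : b.2 = c.2.
    apply/eqP; rewrite eq_le tc ?tb //; first by rewrite bc -surjective_pairing.
    by rewrite -bc -surjective_pairing.
  have bd : b.1 < d.1 by rewrite bc.
  have := top_point_concave convK Ka Kd (conj Kb tb) ab bd.
  by rewrite /det2 /= -bc -e; lra.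
have := top_point_concave convK Ka Kc (conj Kb tb) ab bc.
have := top_point_concave convK Kb Kd (conj Kc tc) bc cd.
rewrite /det2 /= => h1 h2.
have bc0 : 0 < c.1 - b.1 by lra.
have cd0 : 0 <= d.1 - c.1 by lra.
have ab0 : 0 <= b.1 - a.1 by lra.
rewrite -(pmulr_lle0 _ bc0).
by have := ler_wpM2r cd0 h2; have := ler_wpM2r ab0 h1; lra.
Qed.

(** A linear form that is nonpositive on every edge is smallest where all edges are taken in
    full. *)
Lemma zonotope_det_le0 E u p : (forall v, v \in E -> det2 v u <= 0) ->
  zonotope E p -> det2 (vsum E) u <= det2 p u.
Proof.
elim: E p => [|v E IH] p Eu /=; first by move=> ->; rewrite /vsum !big_nil.
move=> [_ [b [[t /andP[t0 t1] ->] [Eb ->]]]].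
have h1 := Eu v (mem_head _ _).
have h2 := IH b (fun w wE => Eu w (mem_behead (s := v :: E) wE)) Eb.
have -> : det2 (vsum (v :: E)) u = det2 v u + det2 (vsum E) u.
  by rewrite vsum_cons /det2 /=; ring.
rewrite [X in _ <= X](_ : _ = t * det2 v u + det2 b u); last by rewrite /det2 /=; ring.
by nra.
Qed.

Lemma zonotope_det_ge0 E u p : (forall v, v \in E -> 0 <= det2 v u) ->
  zonotope E p -> 0 <= det2 p u.
Proof.
elim: E p => [|v E IH] p Eu /=; first by move=> ->; rewrite /det2 /=; lra.
move=> [_ [b [[t /andP[t0 t1] ->] [Eb ->]]]].
have h1 := Eu v (mem_head _ _).
have h2 := IH b (fun w wE => Eu w (mem_behead (s := v :: E) wE)) Eb.
rewrite (_ : det2 (_, _) u = t * det2 v u + det2 b u); last by rewrite /det2 /=; ring.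
by rewrite addr_ge0 // mulr_ge0.
Qed.

(* The steps of a concave chain have decreasing slopes, so a point of their zonotope
   lies below the line carrying the step over which it projects. *)
Lemma zonotope_steps_below K p s z : convex_set2 K -> path ltx p s ->
  (forall q, q \in p :: s -> top_point K q) -> zonotope (steps p s) z ->
  exists2 y, p.2 + z.2 <= y & K (p.1 + z.1, y).
Proof.
move=> convK ps tops Zz.
have s0 e : e \in steps p s -> 0 <= e.1.
  by move=> /(mem_steps ps)[a [b [_ _ ab ->]]] /=; lra.
have := zonotope_fst_bound s0 Zz; rewrite vsum_steps /= => /andP[z0 z1].
have : p.1 <= p.1 + z.1 <= (last p s).1 by apply/andP; split; lra.
move=> /path_locate[e|[s1 [q [s2 [sE /andP[h1 h2]]]]]].
  exists p.2; first by rewrite e in Zz; rewrite Zz /= addr0.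
  have -> : p.1 + z.1 = p.1 by rewrite e in z1; move: z1 => /=; lra.
  by rewrite -surjective_pairing; have [] := tops p (mem_head _ _).
pose c := last p s1; pose e := (q.1 - c.1, q.2 - c.2).
have csub : c \in p :: s1 by exact: mem_last.
have sub1 r : r \in p :: s1 -> r \in p :: s.
  by rewrite sE !inE mem_cat => /orP[->|->]; rewrite ?orbT.
have sub2 r : r \in q :: s2 -> r \in p :: s.
  by rewrite sE !inE mem_cat inE => /orP[->|->]; rewrite ?orbT.
have topc := tops c (sub1 c csub).
have topq := tops q (sub2 q (mem_head _ _)).
move: ps; rewrite sE cat_path /= => /and3P[p1 cq p2].
move: Zz; rewrite sE steps_cat zonotope_cat => -[a [b [Za [Zb zE]]]].
(* Let [e] be the step from [c] to [q] over which the point projects. The edges before it have at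
   least its slope, those from it on at most its slope. Adding both bounds shows that the point is
   not above the line through [c] and [q]. *)
have {Za} da : det2 (vsum (steps p s1)) e <= det2 a e.
  apply: zonotope_det_le0 Za => v /(mem_steps p1)[x [y [xs ys xy ->]]].
  apply: (top_point_steps convK) => //.
  - exact/tops/sub1.
  - exact/tops/sub1.
  - exact: path_last_ge.
have {Zb} db : 0 <= det2 b e.
  apply: zonotope_det_ge0 Zb => v /=.
  rewrite inE => /orP[/eqP ->|/(mem_steps p2)[x [y [xs ys xy ->]]]].
    by rewrite /det2 /e /=; lra.
  rewrite -oppr_le0 (_ : - det2 _ _ = det2 e (y.1 - x.1, y.2 - x.2)); last first.
    by rewrite /det2 /=; ring.
  apply: (top_point_steps convK) => //.
  - exact/tops/sub2.
  - exact/tops/sub2.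
  - exact: (path_first_le p2 xs).
have cq0 : 0 < q.1 - c.1 by rewrite subr_gt0.
pose t := (p.1 + z.1 - c.1) / (q.1 - c.1).
have t01 : 0 <= t <= 1 by rewrite divr_ge0 ?ler_pdivrMr //=; rewrite -/c in h1; lra.
have tE : t * (q.1 - c.1) = p.1 + z.1 - c.1 by rewrite divfK // gt_eqF.
exists (t * q.2 + (1 - t) * c.2); last first.
  have := convK _ _ t (proj1 topq) (proj1 topc) t01; congr (K (_, _)).
  transitivity (t * (q.1 - c.1) + c.1); first by ring.
  by rewrite tE subrK.
rewrite -(ler_pM2r cq0).
have -> : (t * q.2 + (1 - t) * c.2) * (q.1 - c.1) =
  t * (q.1 - c.1) * (q.2 - c.2) + c.2 * (q.1 - c.1) by ring.
rewrite tE; move: da db; rewrite vsum_steps -/c zE /det2 /e /=; lra.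
Qed.

End Approximation.

(** * Polygons inside and around a convex body *)

Section Approximation.
Variable R : realType.
Implicit Types (K L A B : set (R * R)) (p q u v : R * R) (E F : seq (R * R)).

Definition reflect2 p : R * R := (p.1, - p.2).

Lemma steps_reflect2 p s :
  steps (reflect2 p) (map reflect2 s) = map reflect2 (steps p s).
Proof.
elim: s p => //= q s IH p; rewrite IH; congr (_ :: _).
by rewrite /reflect2 /=; congr (_, _); ring.
Qed.

(** Reflection in the horizontal axis turns the lower boundary into an upper one. *)
Lemma zonotope_steps_above K p s z : convex_set2 K -> path (@ltx R) p s ->
  (forall q, q \in p :: s -> K q /\ forall y, K (q.1, y) -> q.2 <= y) ->
  zonotope (steps p s) z ->
  exists2 y, y <= p.2 + z.2 & K (p.1 + z.1, y).
Proof.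
move=> convK ps bots Zz.
pose K' : set (R * R) := [set q | K (reflect2 q)].
have convK' : convex_set2 K'.
  move=> a b t Ka Kb t01; have := convK _ _ t Ka Kb t01.
  by rewrite /K' /reflect2 /=; congr (K (_, _)); ring.
have ps' : path (@ltx R) (reflect2 p) (map reflect2 s) by rewrite path_map.
have tops q : q \in reflect2 p :: map reflect2 s -> top_point K' q.
  rewrite -map_cons => /mapP[r /bots[Kr rb] ->]; rewrite /top_point /K' /reflect2 /=.
  rewrite opprK -surjective_pairing; split => // y /rb; lra.
have Zz' : zonotope (steps (reflect2 p) (map reflect2 s)) (reflect2 z).
  rewrite steps_reflect2 zonotope_image; first by exists z.
  - by rewrite /reflect2 /= oppr0.
  - by move=> a b; rewrite /reflect2 /= opprD.
  - by move=> t a; rewrite /reflect2 /= mulrN.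
have [y hy Ky] := zonotope_steps_below convK' ps' tops Zz'.
by exists (- y); [move: hy => /=; lra|exact: Ky].
Qed.

Lemma section_bounds K : compact K -> convex_set2 K -> exists lo hi : R -> R,
  forall x y0, K (x, y0) -> lo x <= hi x /\ forall y, K (x, y) <-> lo x <= y <= hi x.
Proof.
move=> cK convK.
have h x : exists cd : R * R, forall y0, K (x, y0) ->
    cd.1 <= cd.2 /\ forall y, K (x, y) <-> cd.1 <= y <= cd.2.
  have [[y Ky]|nK] := pselect (exists y, K (x, y)).
    by have [c [d h]] := section_itv cK convK Ky; exists (c, d).
  by exists (0, 0) => y Ky; case: nK; exists y.
have [f fP] := choice h.
by exists (fun x => (f x).1), (fun x => (f x).2) => x; exact: fP.
Qed.

(** The nodes are the highest and lowest points of [K] over the abscissae of [s]. Each point of [s]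
    lies between the two nodes over it, and by concavity the polygon does not leave [K]. *)
Lemma polygon_nodes K (s : seq (R * R)) : compact K -> convex_set2 K ->
  s != [::] -> (forall p, p \in s -> K p) ->
  exists p E F, [/\ chains E F, forall q, q \in s -> translate p (polygon E F) q &
    translate p (polygon E F) `<=` K].
Proof.
move=> cK convK s0 sK; have [lo [hi lohi]] := section_bounds cK convK.
(* Points of [s] may share an abscissa; without repetitions the nodes strictly advance to the
   right. *)
pose xs := sort <=%O (undup (map fst s)).
have memxs x : (x \in xs) = (x \in map fst s) by rewrite mem_sort mem_undup.
have lt_xs : sorted <%O xs by rewrite sort_lt_sorted undup_uniq.
have xs0 : xs != [::].
  case: s s0 @xs memxs {sK lt_xs} => // q s _ xs memxs.
  have : q.1 \in xs by rewrite memxs mem_head.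
  by case: xs {memxs}.
have Kxs x : x \in xs -> lo x <= hi x /\ forall y, K (x, y) <-> lo x <= y <= hi x.
  rewrite memxs => /mapP[q /sK Kq ->]; apply: (lohi _ q.2).
  by rewrite -surjective_pairing.
case: xs => [//|x0 xs] in memxs lt_xs xs0 Kxs *.
have pathE (f : R -> R) :
    path (@ltx R) (x0, f x0) (map (fun x => (x, f x)) xs) by rewrite path_map.
pose nodes (f : R -> R) := map (fun x => (x, f x)) xs.
have last_nodes f : last (x0, f x0) (nodes f) = (last x0 xs, f (last x0 xs)).
  by rewrite -(last_map (fun x => (x, f x))).
have K0 := Kxs x0 (mem_head _ _); have Kl := Kxs _ (mem_last x0 xs).
(* Both chains go from the lowest leftmost node to the highest rightmost one, which makes their sums
   equal: the upper chain contains the left vertical edge, the lower chain the right one. Either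
   edge may be zero. *)
pose E := (0, hi x0 - lo x0) :: steps (x0, hi x0) (nodes hi).
pose F := rcons (steps (x0, lo x0) (nodes lo)) (0, hi (last x0 xs) - lo (last x0 xs)).
have nodeP (f : R -> R) q : q \in (x0, f x0) :: nodes f ->
    q.1 \in x0 :: xs /\ q.2 = f q.1.
  by rewrite -(map_cons (fun x => (x, f x))) => /mapP[x xin ->].
have step0 (f : R -> R) e : e \in steps (x0, f x0) (nodes f) -> 0 <= e.1.
  by move=> /(mem_steps (pathE f))[a [b [_ _ ab ->]]] /=; lra.
exists (x0, lo x0), E, F; split.
- split.
  + by move=> v; rewrite inE => /orP[/eqP -> //|]; exact: step0.
  + by move=> v; rewrite mem_rcons inE => /orP[/eqP -> //|]; exact: step0.
  + rewrite /E /F -cats1 vsum_cat !vsum_cons !vsum_steps !last_nodes /vsum !big_nil /=.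
    by congr (_, _); ring.
- move=> q qs; have qxs : q.1 \in x0 :: xs by rewrite memxs map_f.
  have [lh KE] := Kxs _ qxs.
  have /KE/andP[h1 h2] : K (q.1, q.2) by rewrite -surjective_pairing; exact: sK.
  apply/translateP; split => /=.
    exists (hi q.1 - q.2); first by rewrite subr_ge0.
    exists (0, hi x0 - lo x0), (q.1 - x0, hi q.1 - hi x0); split.
      by exists 1; rewrite ?ler01 ?lexx // !mul1r.
    split; last by congr (_, _) => /=; ring.
    apply: (zonotope_steps (p := (x0, hi x0)) (q := (q.1, hi q.1))).
    by rewrite -(map_cons (fun x => (x, hi x))); apply: map_f.
  exists (q.2 - lo q.1); first by rewrite subr_ge0.
  rewrite /F -cats1 zonotope_cat.
  exists (q.1 - x0, lo q.1 - lo x0), (0, 0); split.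
    apply: (zonotope_steps (p := (x0, lo x0)) (q := (q.1, lo q.1))).
    by rewrite -(map_cons (fun x => (x, lo x))); apply: map_f.
  split; first exact: zonotope0.
  by congr (_, _) => /=; ring.
move=> q /translateP[[c c0 Ec] [d d0 Fd]].
have [y1 y1q Ky1] : exists2 y, q.2 <= y & K (q.1, y).
  move: Ec => [_ [b [[t /andP[t0 t1] ->] [Zb [/= e1 e2]]]]].
  have [|y hy Ky] := zonotope_steps_below convK (pathE hi) _ Zb.
    move=> r /nodeP[rxs r2]; have [lh KE] := Kxs _ rxs.
    rewrite [r]surjective_pairing r2; split => /=.
      by apply/KE; rewrite lh lexx.
    by move=> y /KE/andP[].
  exists y; last by move: Ky => /=; congr (K (_, _)); rewrite mulr0 add0r in e1; lra.
  move: K0 => [K0 _]; have := mulr_ge0 t0 (eqbRL (subr_ge0 _ _) K0); move: hy => /=; nra.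
have [y2 y2q Ky2] : exists2 y, y <= q.2 & K (q.1, y).
  move: Fd; rewrite /F -cats1 zonotope_cat.
  move=> [b [_ [Zb [[_ [_ [[t /andP[t0 t1] ->] [-> ->]]]] [/= e1 e2]]]]].
  have [|y hy Ky] := zonotope_steps_above convK (pathE lo) _ Zb.
    move=> r /nodeP[rxs r2]; have [lh KE] := Kxs _ rxs.
    rewrite [r]surjective_pairing r2; split => /=.
      by apply/KE; rewrite lh lexx.
    by move=> y /KE/andP[].
  exists y; last by move: Ky => /=; congr (K (_, _)); lra.
  move: Kl => [Kl _]; have := mulr_ge0 t0 (eqbRL (subr_ge0 _ _) Kl); move: hy => /=; nra.
have [_ KE] := lohi _ _ Ky1; rewrite [q]surjective_pairing; apply/KE.
by move: Ky1 Ky2 => /KE/andP[? ?] /KE/andP[? ?]; apply/andP; split; lra.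
Qed.

(** Serves both as upper and as lower chain of a square, since zonotopes ignore the order of the
    edges. *)
Definition square_edges (d : R) : seq (R * R) := [:: (2 * d, 0); (0, 2 * d)].

Lemma polygon_square d : 0 <= d ->
  translate (- d, - d) (polygon (square_edges d) (square_edges d)) = box d.
Proof.
move=> d0.
have sqP p : polygon (square_edges d) (square_edges d) p <->
    0 <= p.1 <= 2 * d /\ 0 <= p.2 <= 2 * d.
  have zP q : zonotope (square_edges d) q <->
      exists2 t, 0 <= t <= 1 & exists2 s, 0 <= s <= 1 & q = (t * (2 * d), s * (2 * d)).
    split.
      move=> [_ [_ [[t t01 ->] [[_ [_ [[s s01 ->] [-> ->]]]] ->]]]].
      by exists t => //; exists s => //; congr (_, _) => /=; ring.
    move=> [t t01 [s s01 ->]].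
    exists (t * (2 * d), t * 0), (s * 0, s * (2 * d)); split; first by exists t.
    split; last by congr (_, _) => /=; ring.
    exists (s * 0, s * (2 * d)), (0, 0); split; first by exists s.
    by split => //; congr (_, _) => /=; ring.
  split.
    move=> [[c c0 /zP[t /andP[t0 t1] [s /andP[s0 s1] [e1 e2]]]]
            [c' c0' /zP[t' /andP[t0' t1'] [s' /andP[s0' s1'] [e1' e2']]]]].
    by split; apply/andP; split; nra.
  move=> [/andP[h1 h2] /andP[h3 h4]].
  have [dE|dN] := eqVneq d 0.
    have p0 : p = (0, 0) by rewrite [p]surjective_pairing; congr (_, _); lra.
    by rewrite p0; split; exists 0 => //; rewrite ?addr0 ?subr0; exact: zonotope0.
  have d1 : 0 < 2 * d by lra.
  have Zp : zonotope (square_edges d) p.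
    apply/zP; exists (p.1 / (2 * d)); first by rewrite divr_ge0 ?ler_pdivrMr //=; lra.
    exists (p.2 / (2 * d)); first by rewrite divr_ge0 ?ler_pdivrMr //=; lra.
    by rewrite !divfK ?gt_eqF // -surjective_pairing.
  by split; exists 0 => //; rewrite ?addr0 ?subr0 -surjective_pairing.
apply/seteqP; split => p.
  move=> /translateP/sqP[/= /andP[? ?] /andP[? ?]].
  by split; rewrite ler_norml; apply/andP; split; lra.
move=> [/=]; rewrite !ler_norml => /andP[? ?] /andP[? ?].
by apply/translateP/sqP; split; apply/andP; split => /=; lra.
Qed.

(** An inscribed polygon through a net of [K] is enlarged by a square of half-side [d]: the net
    makes it cover [K], inscription keeps it near [K], and the square gives it positive width even
    if [K] is a point or a vertical segment. *)
Lemma convex_body_approx K (d : R) : convex_body2 K -> 0 < d ->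
  exists p E F, [/\ chains E F, 0 < (vsum E).1, K `<=` translate p (polygon E F) &
    translate p (polygon E F) `<=` msum K (box d)].
Proof.
move=> [[k Kk] [cK convK]] d0; have [s [sK sN]] := compact_net cK d0.
have s0 : s != [::].
  by have [q [qs _ _]] := sN k Kk; case: s qs {sK sN}.
have [p [E [F [EF Ps PK]]]] := polygon_nodes cK convK s0 sK.
pose Q := square_edges d.
have QQ : chains Q Q.
  by split=> // v; rewrite !inE => /orP[] /eqP -> //=; lra.
have EQ : translate (p.1 - d, p.2 - d) (polygon (E ++ Q) (F ++ Q)) =
    msum (translate p (polygon E F)) (box d).
  by rewrite -(polygon_square (ltW d0)) msum_translate msum_polygon.
exists (p.1 - d, p.2 - d), (E ++ Q), (F ++ Q); rewrite EQ; split.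
- exact: chains_cat.
- rewrite vsum_cat /= ltr_wpDl //.
    by have [E0 _ _] := EF; rewrite /= big_seq; apply: sumr_ge0.
  by rewrite !big_cons big_nil /=; lra.
- move=> q /sN[r [rs h1 h2]]; exists r, (q.1 - r.1, q.2 - r.2).
  split; first exact: Ps.
  split; first by split; exact: ltW.
  by rewrite [q]surjective_pairing; congr (_, _) => /=; ring.
- by move=> _ [a [b [/PK Ka [bb ->]]]]; exists a, b.
Qed.

End Approximation.

(** * Reduction of the number of edges *)

Section Configurations.
Variable R : realType.
Implicit Types (K L A B : set (R * R)) (p q u v : R * R) (E F : seq (R * R)).

Lemma common_lower_bound (T : finType) (f : T -> R) : (forall t, 0 < f t) ->
  exists2 d, 0 < d & forall t, d <= f t.
Proof.
move=> f0; suff [d d0 dP] : exists2 d, 0 < d & forall t, t \in enum T -> d <= f t.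
  by exists d => // t; apply: dP; rewrite mem_enum.
elim: (enum T) => [|t s [d d0 dP]]; first by exists 1.
exists (Num.min d (f t)); first by rewrite lt_min d0 f0.
move=> u; rewrite inE => /orP[/eqP ->|/dP h]; first by rewrite ge_min lexx orbT.
by rewrite ge_min h.
Qed.

Lemma msum_box K L (d : R) :
  msum (msum K (box d)) (msum L (box d)) `<=` msum (msum K L) (box (d + d)).
Proof.
move=> _ [_ [_ [[a [b [Ka [[b1 b2] ->]]]] [[a' [b' [La [[b1' b2'] ->]]]] ->]]]].
exists (a.1 + a'.1, a.2 + a'.2), (b.1 + b'.1, b.2 + b'.2).
split; first by exists a, a'.
split; last by congr (_, _) => /=; ring.
by split; apply: (le_trans (ler_normD _ _)); exact: lerD.
Qed.

Lemma box_le (d e : R) : d <= e -> box d `<=` box e.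
Proof. by move=> de p [h1 h2]; split; apply: le_trans de. Qed.

Lemma msum_subset K K' L L' : K `<=` K' -> L `<=` L' -> msum K L `<=` msum K' L'.
Proof. by move=> KK LL _ [a [b [/KK Ka [/LL Lb ->]]]]; exists a, b. Qed.

(** Each body gets one polygon that serves in all pairs. The areas of the two bodies and of their
    sum each grow by less than [e / 2], which moves the mixed area by less than [e]. *)
Lemma mixed_area_approx (n : nat) (K : 'I_n -> set (R * R)) (e : R) :
  (forall i, convex_body2 (K i)) -> 0 < e ->
  exists E F : 'I_n -> seq (R * R),
    [/\ forall i, chains (E i) (F i), forall i, 0 < (vsum (E i)).1 &
      forall i j, `|mixed_area (K i) (K j) -
        (cross_area (E i) (E j) + cross_area (F i) (F j)) / 4| < e].
Proof.
move=> cbK e0; have cK i : compact (K i) by case: (cbK i) => _ [].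
have e1 : 0 < e / 2 by lra.
have [f1 f1P] := choice (fun i => let: ex_intro2 d d0 dP :=
  vol2_outer_continuous (cK i) e1 in ex_intro (fun d => 0 < d /\
    forall L, compact L -> K i `<=` L -> L `<=` msum (K i) (box d) ->
    vol2 (K i) <= vol2 L < vol2 (K i) + e / 2) d (conj d0 dP)).
have [f2 f2P] := choice (fun ij : 'I_n * 'I_n => let: ex_intro2 d d0 dP :=
  vol2_outer_continuous (compact_msum (cK ij.1) (cK ij.2)) e1 in
  ex_intro (fun d => 0 < d /\
    forall L, compact L -> msum (K ij.1) (K ij.2) `<=` L ->
    L `<=` msum (msum (K ij.1) (K ij.2)) (box d) ->
    vol2 (msum (K ij.1) (K ij.2)) <= vol2 L < vol2 (msum (K ij.1) (K ij.2)) + e / 2)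
  d (conj d0 dP)).
have [d1 d10 d1P] := common_lower_bound (fun i => proj1 (f1P i)).
have [d2 d20 d2P] := common_lower_bound (fun ij => proj1 (f2P ij)).
(* The half is there because the enlargements of two summands by [d] add up to one by [d + d]. *)
pose d := Num.min d1 (d2 / 2).
have d0 : 0 < d by rewrite lt_min d10 divr_gt0.
have dd1 : d <= d1 by rewrite ge_min lexx.
have dd2 : d + d <= d2 by have : d <= d2 / 2 by [rewrite ge_min lexx orbT]; lra.
have /choice[g gP] i : exists pEF : (R * R) * seq (R * R) * seq (R * R),
    [/\ chains pEF.1.2 pEF.2, 0 < (vsum pEF.1.2).1,
      K i `<=` translate pEF.1.1 (polygon pEF.1.2 pEF.2) &
      translate pEF.1.1 (polygon pEF.1.2 pEF.2) `<=` msum (K i) (box d)].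
  by have [p [E [F h]]] := convex_body_approx (cbK i) d0; exists (p, E, F).
exists (fun i => (g i).1.2), (fun i => (g i).2); split => [i|i|i j].
- by case: (gP i).
- by case: (gP i).
have [Ci Wi Ki Pi] := gP i; have [Cj Wj Kj Pj] := gP j.
rewrite -(mixed_area_polygon (g i).1.1 (g j).1.1 Ci Cj Wi Wj).
set Qi := translate _ _ in Ki Pi *; set Qj := translate _ _ in Kj Pj *.
have cQi : compact Qi by case: (translate_polygon_body (g i).1.1 Ci Wi) => _ [].
have cQj : compact Qj by case: (translate_polygon_body (g j).1.1 Cj Wj) => _ [].
have /andP[a1 a2] : vol2 (K i) <= vol2 Qi < vol2 (K i) + e / 2.
  apply: (proj2 (f1P i)) => //; apply: (subset_trans Pi); apply: msum_subset => //.
  by apply: box_le; exact: le_trans (d1P i).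
have /andP[b1 b2] : vol2 (K j) <= vol2 Qj < vol2 (K j) + e / 2.
  apply: (proj2 (f1P j)) => //; apply: (subset_trans Pj); apply: msum_subset => //.
  by apply: box_le; exact: le_trans (d1P j).
have /andP[c1 c2] : vol2 (msum (K i) (K j)) <= vol2 (msum Qi Qj) <
    vol2 (msum (K i) (K j)) + e / 2.
  apply: (proj2 (f2P (i, j))); first exact: compact_msum.
    exact: msum_subset.
  apply: (subset_trans (msum_subset Pi Pj)).
  apply: (subset_trans (@msum_box _ _ _)); apply: msum_subset => //.
  by apply: box_le; exact: le_trans (d2P (i, j)).
rewrite /mixed_area ltr_norml; move: a1 a2 b1 b2 c1 c2.
move: (vol2 (K i)) (vol2 (K j)) (vol2 (msum (K i) (K j))) (vol2 Qi) (vol2 Qj)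
  (vol2 (msum Qi Qj)) => x1 x2 x3 y1 y2 y3 *.
by apply/andP; split; lra.
Qed.

End Configurations.

(** * Caratheodory's theorem for cones *)

Section Caratheodory.
Variable R : realType.
Implicit Types (u v : R * R) (E F : seq (R * R)).

Definition scale2 (c : R) v : R * R := (c * v.1, c * v.2).

(** A matrix with more rows than columns has a nonzero vector in its left kernel; its sign is chosen
    so that some entry is positive. *)
Lemma linear_dependence (T : finType) m (f : 'I_m -> T -> R) : (#|T| < m)%N ->
  exists c : 'I_m -> R, (exists i, 0 < c i) /\ forall t, \sum_i c i * f i t = 0.
Proof.
move=> Tm; pose A : 'M[R]_(m, #|T|) := \matrix_(i, t) f i (enum_val t).
have : kermx A != 0.
  rewrite kermx_eq0 /row_free; apply: contraTneq Tm => <-.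
  by rewrite -leqNgt rank_leq_col.
move=> /rowV0Pn[c /sub_kermxP cA c0].
have [i ci] : exists i, c 0 i != 0.
  apply: contrapT => h; move/eqP: c0; apply; apply/rowP => i; rewrite mxE.
  by apply/eqP; apply: contrapT => ci; apply: h; exists i; exact/negP.
have cf t : \sum_i c 0 i * f i t = 0.
  have := congr1 (fun B : 'rV_#|T| => B 0 (enum_rank t)) cA; rewrite !mxE => h.
  by rewrite -[RHS]h; apply: eq_bigr => j _; rewrite ?mxE enum_rankK.
have [c_gt0|c_le0] := ltP 0 (c 0 i); first by exists (c 0); split => //; exists i.
exists (fun j => - c 0 j); split; first by exists i; rewrite oppr_gt0 lt_neqAle ci.
by move=> t; under eq_bigr do rewrite mulNr; rewrite sumrN cf oppr0.
Qed.

(* Subtracting a suitable multiple of a linear dependence makes one weight vanish while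
   the others stay nonnegative. *)
Lemma conic_caratheodory (T : finType) (phi : T -> R * R -> R) (E : seq (R * R)) :
  (forall t c v, 0 <= c -> phi t (scale2 c v) = c * phi t v) ->
  (forall v, v \in E -> 0 <= v.1) ->
  exists E', [/\ (size E' <= #|T|)%N, forall v, v \in E' -> 0 <= v.1 &
    forall t, \sum_(v <- E') phi t v = \sum_(v <- E) phi t v].
Proof.
move=> phiZ; have [m] := ubnP (size E); elim: m E => // m IH E; rewrite ltnS => Em E0.
have [sE|sE] := leqP (size E) #|T|; first by exists E.
pose e (i : 'I_(size E)) := tnth (in_tuple E) i.
have [c [[i1 ci1] cE]] := linear_dependence (fun i t => phi t (e i)) sE.
(* Dividing by the largest coefficient makes every weight [1 - c i / c i0] nonnegative and the one
   of [i0] zero. Nonnegative weights are needed because [phi] is only positively homogeneous. *)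
have [i0 _ cmax] := @arg_maxP _ _ _ i1 xpredT c isT.
have ci0 : 0 < c i0 by apply: lt_le_trans ci1 (cmax i1 isT).
pose w i := 1 - c i / c i0.
have w0 i : 0 <= w i by rewrite subr_ge0 ler_pdivrMr // mul1r; exact: cmax.
pose E1 := [seq scale2 (w i) (e i) | i <- enum 'I_(size E) & i != i0].
have sizeE1 : (size E1 < size E)%N.
  rewrite size_map size_filter -[X in (_ < X)%N](size_enum_ord (size E)).
  rewrite -(count_predC (fun i => i != i0) (enum 'I_(size E))) -[ltnLHS]addn0 ltn_add2l.
  by rewrite -has_count; apply/hasP; exists i0; rewrite ?mem_enum //= negbK.
have E10 v : v \in E1 -> 0 <= v.1.
  by move=> /mapP[i _ ->] /=; rewrite mulr_ge0 // E0 // /e mem_tnth.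
have sumE1 t : \sum_(v <- E1) phi t v = \sum_(v <- E) phi t v.
  have wE : \sum_i w i * phi t (e i) = \sum_(v <- E) phi t v.
    rewrite [RHS]big_tnth.
    transitivity (\sum_i phi t (e i) - (c i0)^-1 * \sum_i c i * phi t (e i)).
      by rewrite mulr_sumr -sumrB; apply: eq_bigr => i _; rewrite /w; ring.
    by rewrite cE mulr0 subr0.
  rewrite -wE big_map big_filter big_enum_cond /= [RHS](bigD1 i0) //=.
  rewrite {2}/w divff ?gt_eqF // subrr mul0r add0r.
  by apply: eq_bigr => i _; rewrite phiZ.
have [|E' [s1 s2 s3]] := IH E1 _ E10; first exact: leq_trans sizeE1 Em.
by exists E'; split => // t; rewrite s3.
Qed.

Lemma cross_areaC E F : cross_area E F = cross_area F E.
Proof.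
rewrite /cross_area exchange_big; apply: eq_bigr => u _; apply: eq_bigr => v _.
by rewrite -normrN; congr (`|_|); rewrite /det2; ring.
Qed.

(** Caratheodory's theorem for [n + 2] positively homogeneous functions of an edge: its
    contributions to the cross areas with the [n] chains and its two coordinates. *)
Lemma reduce_chain n (F : 'I_n -> seq (R * R)) E :
  (forall v, v \in E -> 0 <= v.1) ->
  exists E', [/\ (size E' <= n + 2)%N, forall v, v \in E' -> 0 <= v.1,
    vsum E' = vsum E & forall j, cross_area E' (F j) = cross_area E (F j)].
Proof.
move=> E0.
pose phi (t : 'I_n + bool) v : R := match t with
  | inl j => \sum_(u <- F j) `|det2 v u|
  | inr b => if b then v.1 else v.2 end.
have phiZ t c v : 0 <= c -> phi t (scale2 c v) = c * phi t v.
  case: t => [j|[]] //= c0; rewrite mulr_sumr; apply: eq_bigr => u _.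
  rewrite -{2}(ger0_norm c0) -normrM; congr (`|_|).
  by rewrite /det2 /scale2 /=; ring.
have [E' [s1 s2 s3]] := conic_caratheodory phiZ E0.
exists E'; split => //.
- by move: s1; rewrite card_sum card_ord card_bool.
- by congr (_, _); [exact: (s3 (inr true))|exact: (s3 (inr false))].
- by move=> j; exact: (s3 (inl j)).
Qed.

(** The chains are shortened one after another, each against the current version of the others. The
    cross area of a chain with itself is not controlled, as both of its arguments change. *)
Lemma reduce_chains n (E : 'I_n -> seq (R * R)) :
  (forall i v, v \in E i -> 0 <= v.1) ->
  exists E' : 'I_n -> seq (R * R), [/\ forall i, (size (E' i) <= n + 2)%N,
    forall i v, v \in E' i -> 0 <= v.1, forall i, vsum (E' i) = vsum (E i) &
    forall i j, i != j -> cross_area (E' i) (E' j) = cross_area (E i) (E j)].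
Proof.
move=> E0.
suff h k : (k <= n)%N -> exists E' : 'I_n -> seq (R * R),
    [/\ forall i : 'I_n, (i < k)%N -> (size (E' i) <= n + 2)%N,
    forall i v, v \in E' i -> 0 <= v.1, forall i, vsum (E' i) = vsum (E i) &
    forall i j, i != j -> cross_area (E' i) (E' j) = cross_area (E i) (E j)].
  have [E' [h1 h2 h3 h4]] := h n (leqnn n).
  by exists E'; split => // i; apply: h1.
elim: k => [_|k IH kn]; first by exists E.
have [E' [h1 h2 h3 h4]] := IH (ltnW kn).
pose k' := Ordinal kn.
have [D [d1 d2 d3 d4]] := reduce_chain E' (h2 k').
exists (fun i => if i == k' then D else E' i); split.
- move=> i; rewrite ltnS leq_eqVlt => /orP[/eqP ik|ik].
    by rewrite (_ : i == k') //; apply/eqP/val_inj.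
  by case: eqP => // _; exact: h1.
- by move=> i v; case: eqP => [_|_]; [exact: d2|exact: h2].
- by move=> i; case: eqP => [->|_]; rewrite ?d3 h3.
- move=> i j ij; case: (eqVneq i k') => [ik|ik]; case: (eqVneq j k') => [jk|jk].
  + by move: ij; rewrite ik jk eqxx.
  + by rewrite d4 ik -h4 // -ik.
  + by rewrite cross_areaC d4 cross_areaC jk -h4 // -jk.
  + exact: h4.
Qed.

End Caratheodory.

(** * The closure of the configuration space *)

Section ParametrizedConfigurations.
Variables (R : realType) (n N : nat).
Implicit Types E F : seq (R * R).

(* [inl (i, b, k, c)] is a coordinate of the [k]-th edge of the upper ([b = true]) or
   lower chain of the [i]-th polygon; [inr (p, b, k, l)] stands for the absolute value
   of the determinant of two edges, which is not a polynomial. *)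
Definition param : finType :=
  ('I_n * bool * 'I_N * bool + pair_index n * bool * 'I_N * 'I_N)%type.

Definition edge (a : param -> R) i b k : R * R :=
  (a (inl (i, b, k, true)), a (inl (i, b, k, false))).

Definition edge_det (a : param -> R) (p : pair_index n) b k l : R :=
  det2 (edge a (val p).1 b k) (edge a (val p).2 b l).

(** The absolute value of a determinant is characterized by polynomial conditions: it is nonnegative
    and has the same square. *)
Definition admissible (a : param -> R) : Prop :=
  [/\ forall i b k, 0 <= (edge a i b k).1,
    forall i, \sum_k (edge a i true k).1 = \sum_k (edge a i false k).1,
    forall i, \sum_k (edge a i true k).2 = \sum_k (edge a i false k).2,
    forall i, 0 < \sum_k (edge a i true k).1 &
    forall p b k l, 0 <= a (inr (p, b, k, l)) /\
      a (inr (p, b, k, l)) * a (inr (p, b, k, l)) =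
      edge_det a p b k l * edge_det a p b k l].

Definition config (a : param -> R) (p : pair_index n) : R :=
  (\sum_(b : bool) \sum_k \sum_l a (inr (p, b, k, l))) / 4.

Lemma config_PMV a : admissible a -> @PMV R n (config a).
Proof.
move=> [h1 h2 h3 h4 h5].
pose E i b := [seq edge a i b k | k <- enum 'I_N].
have sumE i b (f : R * R -> R) : \sum_(v <- E i b) f v = \sum_k f (edge a i b k).
  by rewrite /E big_map big_enum.
have vsumE i b : vsum (E i b) = (\sum_k (edge a i b k).1, \sum_k (edge a i b k).2).
  by rewrite /vsum !sumE.
have ch i : chains (E i true) (E i false).
  split; [| |by rewrite !vsumE h2 h3].
    by move=> v /mapP[k _ ->]; exact: h1.
  by move=> v /mapP[k _ ->]; exact: h1.
have W i : 0 < (vsum (E i true)).1 by rewrite vsumE; exact: h4.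
exists (fun i => translate (0, 0) (polygon (E i true) (E i false))).
split=> [i|p]; first exact: (translate_polygon_body _ (ch i) (W i)).
rewrite mixed_area_polygon // /config big_bool.
congr ((_ + _) / _); rewrite /cross_area sumE;
  apply: eq_bigr => k _; rewrite sumE; apply: eq_bigr => l _;
  [have [t0 tE] := h5 p true k l|have [t0 tE] := h5 p false k l];
  by rewrite -(ger0_norm t0) -!sqrtr_sqr !expr2 tE.
Qed.

(** Chains shorter than [N] are padded with zero edges, which contribute nothing. *)
Lemma sum_nth_pad E (f : R * R -> R) : f (0, 0) = 0 -> (size E <= N)%N ->
  \sum_(k < N) f (nth (0, 0) E k) = \sum_(v <- E) f v.
Proof.
move=> f0 EN; rewrite (big_nth (0, 0)) big_mkord.
rewrite (big_ord_widen N (fun k => f (nth (0, 0) E k)) EN) [RHS]big_mkcond /=.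
by apply: eq_bigr => k _; case: ltnP => // h; rewrite nth_default.
Qed.

Lemma param_of_chains (E F : 'I_n -> seq (R * R)) :
  (forall i, chains (E i) (F i)) -> (forall i, 0 < (vsum (E i)).1) ->
  (forall i, (size (E i) <= N)%N) -> (forall i, (size (F i) <= N)%N) ->
  exists2 a, admissible a & forall p : pair_index n, config a p =
    (cross_area (E (val p).1) (E (val p).2) + cross_area (F (val p).1) (F (val p).2)) / 4.
Proof.
move=> EF W sE sF.
pose G i (b : bool) := if b then E i else F i.
pose e i b (k : 'I_N) := nth (0, 0) (G i b) k.
pose a (j : param) := match j with
  | inl (i, b, k, c) => if c then (e i b k).1 else (e i b k).2
  | inr (p, b, k, l) => `|det2 (e (val p).1 b k) (e (val p).2 b l)| end.
have edgeE i b k : edge a i b k = e i b k by rewrite /edge /= -surjective_pairing.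
have sG i b : (size (G i b) <= N)%N by case: b; [exact: sE|exact: sF].
have sumE i b (f : R * R -> R) : f (0, 0) = 0 ->
    \sum_k f (edge a i b k) = \sum_(v <- G i b) f v.
  by move=> f0; rewrite -(sum_nth_pad f0 (sG i b)); apply: eq_bigr => k _; rewrite edgeE.
exists a.
  split.
  - move=> i b k; rewrite edgeE /e; have [kG|Gk] := ltnP k (size (G i b)); last first.
      by rewrite nth_default.
    have := mem_nth (0, 0) kG; have [h1 h2 _] := EF i.
    by rewrite /G; case: (b) => [/h1|/h2].
  - by move=> i; rewrite !(sumE _ _ fst) //; have [_ _ [-> _]] := EF i.
  - by move=> i; rewrite !(sumE _ _ snd) //; have [_ _ [_ ->]] := EF i.
  - by move=> i; rewrite (sumE _ _ fst) //; exact: W.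
  - move=> p b k l; split => //=; rewrite /edge_det !edgeE.
    by rewrite -!expr2 real_normK ?num_real.
move=> p; rewrite /config big_bool; congr ((_ + _) / _).
  rewrite /cross_area -[RHS](sum_nth_pad _ (sE _)); last first.
    by rewrite big1 // => v _; rewrite /det2 /= !mul0r subrr normr0.
  apply: eq_bigr => k _; rewrite -[RHS](sum_nth_pad _ (sE _)) //.
  by rewrite /det2 /= !mulr0 subrr normr0.
rewrite /cross_area -[RHS](sum_nth_pad _ (sF _)); last first.
  by rewrite big1 // => v _; rewrite /det2 /= !mul0r subrr normr0.
apply: eq_bigr => k _; rewrite -[RHS](sum_nth_pad _ (sF _)) //.
by rewrite /det2 /= !mulr0 subrr normr0.
Qed.

(** Membership in the closure of the set of admissible configurations, each distance bound being
    split into two strict polynomial inequalities so as to be a first-order condition. *)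
Definition near_config (x : pair_index n -> R) : Prop := forall e : R, 0 < e ->
  exists a, admissible a /\
    forall p, config a p - e < x p /\ x p < config a p + e.

(** The variables of one formula: [None] is the tolerance, [inl] holds the coordinates of the point
    and [inr] the parameters. *)
Definition var : finType := option (pair_index n + param).

Lemma near_config_semialgebraic : semialgebraic [set x | near_config x].
Proof.
pose none : var := None.
pose point (v : var -> R) (p : pair_index n) := v (Some (inl p)).
pose params (v : var -> R) (j : param) := v (Some (inr j)).
(* The formula is built from inside out: [Q1] has no quantifier over reals, [Q2] quantifies the
   parameters existentially and [Q3] the tolerance universally. *)
pose Q1 (v : var -> R) := admissible (params v) /\
  forall p, config (params v) p - v none < point v p /\
            point v p < config (params v) p + v none.
pose s : seq var := [seq Some (inr j) | j <- enum param].
pose Q2 (v : var -> R) := exists c : var -> R, Q1 (fun i => if i \in s then c i else v i).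
pose Q3 (v : var -> R) := forall e, 0 < @update R var v none e none -> Q2 (@update R var v none e).
have pconfig p : polynomial_fun (fun v : var -> R => config (params v) p).
  apply: polynomialM; last exact: polynomial_const.
  apply: polynomial_sum => b; apply: polynomial_sum => k; apply: polynomial_sum => l.
  exact: polynomial_var.
have psum (f : R * R -> R) i b : (forall k, polynomial_fun
    (fun v : var -> R => f (edge (params v) i b k))) ->
    polynomial_fun (fun v : var -> R => \sum_k f (edge (params v) i b k)).
  by move=> h; apply: polynomial_sum.
have pdet p b k l : polynomial_fun (fun v : var -> R => edge_det (params v) p b k l).
  by apply: polynomialB; apply: polynomialM; exact: polynomial_var.
have dQ1 : definable Q1.
  apply: definable_and.
    apply: (@eq_definable _ _ (fun v : var -> R =>
      (forall i b k, 0 <= (edge (params v) i b k).1) /\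
      (forall i, \sum_k (edge (params v) i true k).1 = \sum_k (edge (params v) i false k).1) /\
      (forall i, \sum_k (edge (params v) i true k).2 = \sum_k (edge (params v) i false k).2) /\
      (forall i, 0 < \sum_k (edge (params v) i true k).1) /\
      (forall p b k l, 0 <= params v (inr (p, b, k, l)) /\
      params v (inr (p, b, k, l)) * params v (inr (p, b, k, l)) =
      edge_det (params v) p b k l * edge_det (params v) p b k l))).
      by move=> v; split=> [[? [? [? []]]]|[]].
    do !apply: definable_and.
    - do 3!apply: definable_forall_fin => ?.
      by apply: definable_le; [exact: polynomial_const|exact: polynomial_var].
    - apply: definable_forall_fin => i; apply: definable_eq; apply: psum => k;
      exact: polynomial_var.
    - apply: definable_forall_fin => i; apply: definable_eq; apply: psum => k;
      exact: polynomial_var.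
    - apply: definable_forall_fin => i; apply: definable_lt; first exact: polynomial_const.
      by apply: psum => k; exact: polynomial_var.
    - do 4!apply: definable_forall_fin => ?; apply: definable_and.
        by apply: definable_le; [exact: polynomial_const|exact: polynomial_var].
      by apply: definable_eq; apply: polynomialM; try exact: pdet; exact: polynomial_var.
  apply: definable_forall_fin => p; apply: definable_and; apply: definable_lt.
  - by apply: polynomialB => //; exact: polynomial_var.
  - exact: polynomial_var.
  - exact: polynomial_var.
  - by apply: polynomialD => //; exact: polynomial_var.
have dQ3 : definable Q3.
  have d0 : @definable R var (fun v : var -> R => 0 < v none -> Q2 v).
    apply: definable_implies; last exact: definable_exists_block.
    by apply: definable_lt; [exact: polynomial_const|exact: polynomial_var].
  exact: (definable_forall none d0).
(* The tolerance and the parameters are bound in [Q3], so substituting 0 for them is harmless and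
   leaves a condition on the coordinates alone. *)
pose sub (i : var) : rpoly R (pair_index n) :=
  if i is Some (inl p) then PVar R p else PConst _ 0.
have := semialgebraic_preimage sub (definable_semialgebraic dQ3).
congr semialgebraic; apply/seteqP; split => x /=; rewrite /Q3 /Q2 /Q1.
  move=> h e e0; have [|c Qc] := h e; first by rewrite /update eqxx.
  pose w (i : var) := if i \in s then c i else update (fun k => peval (sub k) x) none e i.
  have [adm wP] : Q1 w := Qc.
  have w0 : w none = e by rewrite /w ifN ?/update ?eqxx //; apply/mapP => -[].
  have wx p : point w p = x p by rewrite /point /w ifN //; apply/mapP => -[].
  by exists (params w); split => // p; have := wP p; rewrite w0 wx.
move=> h e; rewrite {1}/update eqxx => e0; have [a [adm aP]] := h e e0.
pose c (i : var) := if i is Some (inr j) then a j else 0.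
exists c; pose w (i : var) := if i \in s then c i else update (fun k => peval (sub k) x) none e i.
have wE : params w = a.
  by apply/funext => j; rewrite /params /w ifT //; apply/mapP; exists j; rewrite ?mem_enum.
have w0 : w none = e by rewrite /w ifN ?/update ?eqxx //; apply/mapP => -[].
have wx p : point w p = x p by rewrite /point /w ifN //; apply/mapP => -[].
by change (Q1 w); rewrite /Q1 wE; split => // p; rewrite w0 wx.
Qed.

End ParametrizedConfigurations.

(** From left to right, half of the tolerance is spent on reaching a point of [PMV] and half on
    replacing its bodies by polygons; shortening the chains to [n + 2] edges costs nothing.
    Conversely, every admissible configuration comes from actual polygons. *)
Lemma closure_PMV (R : realType) (n : nat) :
  closureRI (@PMV R n) = [set x | @near_config R n (n + 2) x].
Proof.
apply/seteqP; split => x h e e0 /=; last first.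
  have [a [adm aP]] := h e e0; exists (config a); split; first exact: config_PMV.
  by move=> p; have [h1 h2] := aP p; rewrite ltr_distl; apply/andP.
have e2 : 0 < e / 2 by lra.
have [y [[K [Kb yE]] xy]] := h _ e2.
have [E [F [EF W approx]]] := mixed_area_approx Kb e2.
have [E' [E1 E2 E3 E4]] := reduce_chains (fun i => let: And3 h _ _ := EF i in h).
have [F' [F1 F2 F3 F4]] := reduce_chains (fun i => let: And3 _ h _ := EF i in h).
have EF' i : chains (E' i) (F' i).
  by split; [exact: E2|exact: F2|rewrite E3 F3; case: (EF i)].
have W' i : 0 < (vsum (E' i)).1 by rewrite E3.
have [a adm aE] := param_of_chains EF' W' E1 F1.
exists a; split => // p; rewrite aE.
(* Only pairs of distinct indices are coordinates, and for these the reduction keeps the cross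
   areas. *)
have ij : (val p).1 != (val p).2 by have := valP p; rewrite ltn_neqAle => /andP[].
rewrite E4 // F4 //.
have := approx (val p).1 (val p).2; have := xy p; rewrite yE.
by rewrite !ltr_distl => /andP[? ?] /andP[? ?]; split; lra.
Qed.

Theorem mainTheorem16 (R : realType) (n : nat) :
  (2 <= n)%N -> semialgebraic (closureRI (@PMV R n)).
Proof.
by move=> _; rewrite closure_PMV; exact: near_config_semialgebraic.
Qed.
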